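(* Let $\mathcal{H}$ be a cocommutative Hopf algebra over $\mathbb{C}$ with antipode $S$, and let $\rho$ be an antisymmetric Fox pairing on $\mathcal{H}$ such that the tritensor map $\|-,-,-\|_\rho$ is identically vanishing. Then, for any $N\ge1$, the twisted representation space $\mathrm{Rep}^{\phi,\tau}(\mathcal{H},N)$ with $\phi=S$ is equipped with a Poisson bracket uniquely determined by $\{\!\!\{-,-\}\!\!\}_\rho$ and $\phi=S$ as follows: in the orthogonal case, $$\{a_{ij},b_{kl}\}=\tfrac12(\{\!\!\{a,b\}\!\!\}_\rho)_{kj,il}+\tfrac12(\{\!\!\{S(a),b\}\!\!\}_\rho)_{ki,jl},$$ and in the symplectic case ($N=2n$), $$\{a_{ij},b_{kl}\}=\tfrac12(\{\!\!\{a,b\}\!\!\}_\rho)_{kj,il}+\tfrac12\,\mathrm{sgn}(i)\,\mathrm{sgn}(j)\,(\{\!\!\{S(a),b\}\!\!\}_\rho)_{k\tau(i),\tau(j)l},$$ for $a,b\in\mathcal{H}$ and $1\le i,j,k,l\le N$. If instead the tritensor map satisfies the quasi-Poisson Fox property, i.e. for all $x,y,z\in\mathcal{H}$ $$\|x,y,z\|_\rho=\tfrac14\big(1\otimes y\otimes xz+yx\otimes1\otimes z+x\otimes zy\otimes1+y\otimes z\otimes x-1\otimes zy\otimes x-y\otimes1\otimes xz-yx\otimes z\otimes1-x\otimes y\otimes z\big),$$ the same statement holds except that the induced bracket is quasi-Poisson (for the action of $\mathrm{O}_N$, resp. $\mathrm{Sp}_N$).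
   Context: Algebras are finitely generated over $\mathbb{C}$. $\mathcal{H}$ has comultiplication $\Delta(a)=a_{[1]}\otimes a_{[2]}$, iterated as $\Delta^{k-1}(a)=a_{[1]}\otimes\cdots\otimes a_{[k]}$, counit $\epsilon$, antipode $S$ (which satisfies $S^2=\mathrm{id}$ by cocommutativity). A Fox pairing is a bilinear map $\rho:\mathcal{H}\times\mathcal{H}\to\mathcal{H}$ with $\rho(ab,c)=\rho(a,c)\epsilon(b)+a\rho(b,c)$ and $\rho(a,bc)=\rho(a,b)c+\epsilon(b)\rho(a,c)$. Its transpose is $\overline\rho(a,b)=S(\rho(S(b),S(a)))$; $\rho$ is antisymmetric if $\overline\rho=-\rho$. For antisymmetric $\rho$, the formula $$\{\!\!\{a,b\}\!\!\}_\rho=b_{[1]}S(\rho(a_{[2]},b_{[2]})_{[1]})a_{[1]}\otimes\rho(a_{[2]},b_{[2]})_{[2]}$$ defines a double bracket on $\mathcal{H}$, i.e. a bilinear map $\mathcal{H}\times\mathcal{H}\to\mathcal{H}\otimes\mathcal{H}$ with $\{\!\!\{a,b\}\!\!\}=-\{\!\!\{b,a\}\!\!\}^\circ$ ($(d'\otimes d'')^\circ=d''\otimes d'$), $\{\!\!\{a,bc\}\!\!\}=\{\!\!\{a,b\}\!\!\}(1\otimes c)+(b\otimes1)\{\!\!\{a,c\}\!\!\}$, and the corresponding rule in the first argument. Tritensor map: $\mathtt{F}_\rho(a,b,c)=b_{[1]}S(\rho(a_{[2]},b_{[2]})_{[1]})a_{[1]}\otimes c_{[1]}S\big(\rho(\rho(a_{[2]},b_{[2]})_{[3]},c_{[2]})_{[1]}\big)\rho(a_{[2]},b_{[2]})_{[2]}\otimes\rho(\rho(a_{[2]},b_{[2]})_{[3]},c_{[2]})_{[2]}$,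 and $\|-,-,-\|_\rho=\sum_{s=0,1,2}\tau_{(123)}^{-s}\circ\mathtt{F}_\rho\circ\tau_{(123)}^s:\mathcal{H}^{\otimes3}\to\mathcal{H}^{\otimes3}$, with $\tau_{(123)}(a_1\otimes a_2\otimes a_3)=a_3\otimes a_1\otimes a_2$. $\mathbb{C}[\mathrm{Rep}(\mathcal{H},N)]$ is the commutative algebra generated by $a_{ij}$ ($a\in\mathcal{H}$, $1\le i,j\le N$), linear in $a$, with $(ab)_{ij}=\sum_ra_{ir}b_{rj}$, $1_{ij}=\delta_{ij}$; $\mathtt{X}(a)=(a_{ij})$; $(c\otimes d)_{kj,il}=c_{kj}d_{il}$. $\mathbb{C}[\mathrm{Rep}^{S,\tau}(\mathcal{H},N)]$ is its quotient by the ideal generated by $S(a)_{ij}-a_{ji}$ (orthogonal case, $\tau$ = transposition) or by $S(a)_{ij}-\mathrm{sgn}(i)\mathrm{sgn}(j)a_{\tau(j),\tau(i)}$ (symplectic case, $N=2n$, where $\mathrm{sgn}(k)=1$, $\tau(k)=k+n$ for $k\le n$ and $\mathrm{sgn}(k)=-1$, $\tau(k)=k-n$ for $k>n$). The group $G=\mathrm{O}_N$, resp. $\mathrm{Sp}_N$ (preserving $\begin{pmatrix}0&\mathrm{Id}_n\\-\mathrm{Id}_n&0\end{pmatrix}$), acts by $g\cdot\mathtt{X}(a)=g^{-1}\mathtt{X}(a)g$, with infinitesimal action $\xi\cdot\mathtt{X}(a)=[\mathtt{X}(a),\xi]$. Quasi-Poisson bracket: for $\mathfrak g=\mathrm{Lie}(G)\subset\mathfrak{gl}_N$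 with trace form $\langle\xi,\eta\rangle=\mathrm{tr}(\xi\eta)$ and dual bases $(F_a),(\check F_a)$, let $\psi^{\mathfrak g}=\frac1{12}\sum\langle\check F_a,[\check F_b,\check F_c]\rangle F_a\wedge F_b\wedge F_c$, with $x_1\wedge x_2\wedge x_3=\sum_{\sigma\in S_3}\mathrm{sgn}(\sigma)x_{\sigma(1)}\otimes x_{\sigma(2)}\otimes x_{\sigma(3)}$, and let $\psi$ be the induced triderivation of the coordinate ring through the infinitesimal action. A quasi-Poisson bracket is a $G$-invariant antisymmetric biderivation with $\{f,\{g,h\}\}+\{g,\{h,f\}\}+\{h,\{f,g\}\}=\frac12\psi(f,g,h)$. *)

(* Defs.v *)
From HB Require Import structures.
From mathcomp Require Import all_boot all_order all_algebra all_fingroup.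
From mathcomp Require Import generic_quotient boolp.

Set Implicit Arguments.
Unset Strict Implicit.
Unset Printing Implicit Defensive.

Import GRing.Theory.
Local Open Scope quotient_scope.
Local Open Scope ring_scope.

(* U (x) V is the set of formal sums of pairs (u, v), modulo the smallest
   congruence making (u, v) biadditive and K-balanced.  The scalars act on the
   left factors; [(- u, v)] is the opposite of [(u, v)]. *)
Section Tensor.
Variables (K : fieldType) (U V : lmodType K).
Implicit Types s t : seq (U * V).

Inductive tens_eq : seq (U * V) -> seq (U * V) -> Prop :=
| tens_refl s : tens_eq s s
| tens_sym s t : tens_eq s t -> tens_eq t s
| tens_trans s t r : tens_eq s t -> tens_eq t r -> tens_eq s r
| tens_cat s s' t t' :
    tens_eq s s' -> tens_eq t t' -> tens_eq (s ++ t) (s' ++ t')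
| tens_comm s t : tens_eq (s ++ t) (t ++ s)
| tens_zerol v : tens_eq [:: (0, v)] [::]
| tens_addl u u' v : tens_eq [:: (u + u', v)] [:: (u, v); (u', v)]
| tens_addr u v v' : tens_eq [:: (u, v + v')] [:: (u, v); (u, v')]
| tens_scale k u v : tens_eq [:: (k *: u, v)] [:: (u, k *: v)].

Definition tens_eqb s t : bool := `[< tens_eq s t >].

Lemma tens_eqb_equiv : equiv_class_of tens_eqb.
Proof.
split=> [s|s t|t s r]; first by apply/asboolP; apply: tens_refl.
  by apply/asboolP/asboolP; apply: tens_sym.
by move=> /asboolP h1 /asboolP h2; apply/asboolP; apply: tens_trans h1 h2.
Qed.

Canonical tens_equiv := EquivRelPack tens_eqb_equiv.
Canonical tens_encModRel := defaultEncModRel tens_eqb.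

Definition tensor := {eq_quot tens_eqb}.
HB.instance Definition _ : EqQuotient _ tens_eqb tensor := EqQuotient.on tensor.
HB.instance Definition _ := Choice.on tensor.

Lemma tens_piP s t : \pi_tensor s = \pi_tensor t <-> tens_eq s t.
Proof. by split=> [/eqmodP/asboolP|h] //; apply/eqmodP/asboolP. Qed.

Lemma tens_repr s : tens_eq (repr (\pi_tensor s)) s.
Proof. by apply/tens_piP; rewrite reprK. Qed.

Definition pure_tensor (u : U) (v : V) : tensor := \pi_tensor [:: (u, v)].

Definition tens_map (f : U -> U) s := [seq (f p.1, p.2) | p <- s].

Definition tens_zero : tensor := \pi_tensor [::].
Definition tens_add (x y : tensor) : tensor := \pi_tensor (repr x ++ repr y).
Definition tens_opp (x : tensor) : tensor := \pi_tensor (tens_map -%R (repr x)).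
Definition tens_scl (k : K) (x : tensor) : tensor :=
  \pi_tensor (tens_map ( *:%R k) (repr x)).

Lemma tens_addE s t : tens_add (\pi s) (\pi t) = \pi_tensor (s ++ t).
Proof. by apply/tens_piP; apply: tens_cat; apply: tens_repr. Qed.

Lemma tens_map_eq (f : {additive U -> U}) s t :
    (forall k u, f (k *: u) = k *: f u) ->
  tens_eq s t -> tens_eq (tens_map f s) (tens_map f t).
Proof.
move=> fZ; elim=> {s t} /=.
- by move=> s; apply: tens_refl.
- by move=> s t _; apply: tens_sym.
- by move=> s t r _ h1 _; apply: tens_trans h1.
- by move=> s s' t t' _ h1 _ h2; rewrite /tens_map !map_cat; apply: tens_cat.
- by move=> s t; rewrite /tens_map !map_cat; apply: tens_comm.
- by move=> v; rewrite raddf0; apply: tens_zerol.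
- by move=> u u' v; rewrite raddfD; apply: tens_addl.
- by move=> u v v'; apply: tens_addr.
- by move=> k u v; rewrite fZ; apply: tens_scale.
Qed.

Lemma tens_oppE s : tens_opp (\pi s) = \pi_tensor (tens_map -%R s).
Proof.
apply/tens_piP; apply: tens_map_eq; last exact: tens_repr.
by move=> k u; rewrite scalerN.
Qed.

Lemma tens_sclE k s : tens_scl k (\pi s) = \pi_tensor (tens_map ( *:%R k) s).
Proof.
apply/tens_piP; apply: (@tens_map_eq (GRing.scale k)) (tens_repr s) => l u /=.
by rewrite !scalerA mulrC.
Qed.

Lemma tens_addA : associative tens_add.
Proof.
by elim/quotW=> x; elim/quotW=> y; elim/quotW=> z; rewrite !tens_addE catA.
Qed.

Lemma tens_addC : commutative tens_add.
Proof.
elim/quotW=> x; elim/quotW=> y; rewrite !tens_addE; apply/tens_piP.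
exact: tens_comm.
Qed.

Lemma tens_add0 : left_id tens_zero tens_add.
Proof. by elim/quotW=> x; rewrite !tens_addE. Qed.

Lemma tens_map_merge (f g h : U -> U) s : (forall u, h u = f u + g u) ->
  tens_eq (tens_map f s ++ tens_map g s) (tens_map h s).
Proof.
move=> fgh; elim: s => [|[u v] s IHs] /=; first exact: tens_refl.
apply: tens_trans (_ : tens_eq _ ([:: (f u, v); (g u, v)] ++
                                  (tens_map f s ++ tens_map g s))) _.
  rewrite /= -cat1s -[X in tens_eq _ X]cat1s.
  apply: tens_cat; first exact: tens_refl.
  rewrite -cat1s -[X in tens_eq _ X]cat1s !catA.
  by apply: tens_cat; [apply: tens_comm | apply: tens_refl].
rewrite -[X in tens_eq _ X]cat1s; apply: tens_cat => //.
by apply: tens_sym; rewrite fgh; apply: tens_addl.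
Qed.

Lemma tens_map_zero s : tens_eq (tens_map (fun=> 0) s) [::].
Proof.
elim: s => [|[u v] s IHs] /=; first exact: tens_refl.
rewrite -cat1s -[X in tens_eq _ X]cat0s.
by apply: tens_cat => //; apply: tens_zerol.
Qed.

Lemma tens_map_id s : tens_map id s = s.
Proof. by rewrite /tens_map -[RHS]map_id; apply: eq_map => -[]. Qed.

Lemma tens_addN : left_inverse tens_zero tens_opp tens_add.
Proof.
elim/quotW=> s; rewrite tens_oppE tens_addE; apply/tens_piP.
rewrite -{2}[s]tens_map_id; apply: tens_trans (tens_map_zero s).
by apply: tens_map_merge => u; rewrite addNr.
Qed.

HB.instance Definition _ :=
  GRing.isZmodule.Build tensor tens_addA tens_addC tens_add0 tens_addN.

Lemma tens_sclA a b x : tens_scl a (tens_scl b x) = tens_scl (a * b) x.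
Proof.
elim/quotW: x => s; rewrite !tens_sclE /tens_map -map_comp.
by congr (\pi _); apply: eq_map => p /=; rewrite scalerA.
Qed.

Lemma tens_scl1 : left_id 1 tens_scl.
Proof.
elim/quotW=> s; rewrite !tens_sclE; congr (\pi _); rewrite -[RHS]tens_map_id.
by apply: eq_map => p /=; rewrite scale1r.
Qed.

Lemma tens_sclDr : right_distributive tens_scl +%R.
Proof.
move=> a; elim/quotW=> s; elim/quotW=> t; rewrite /GRing.add /=.
by rewrite !(tens_sclE, tens_addE) /tens_map map_cat.
Qed.

Lemma tens_sclDl x : {morph tens_scl^~ x : a b / a + b}.
Proof.
elim/quotW: x => s a b; rewrite /= [X in _ = X]/GRing.add /=.
rewrite !(tens_sclE, tens_addE); apply/tens_piP/tens_sym.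
by apply: tens_map_merge => u; rewrite scalerDl.
Qed.

HB.instance Definition _ := GRing.Zmodule_isLmodule.Build K tensor
  tens_sclA tens_scl1 tens_sclDr tens_sclDl.

Lemma tens_pi_add s t : \pi_tensor s + \pi_tensor t = \pi_tensor (s ++ t).
Proof. exact: tens_addE. Qed.

Lemma tens_pi_scale k s :
  k *: \pi_tensor s = \pi_tensor (tens_map ( *:%R k) s).
Proof. exact: tens_sclE. Qed.

(* [tlift f] is the linear map with [u (x) v |-> f u v].  It is computed on an
   arbitrary representative, so it is meaningful for bilinear [f] only: see
   [tliftE] and [tlift_linear]. *)
Definition tlift (W : lmodType K) (f : U -> V -> W) (x : tensor) : W :=
  \sum_(p <- repr x) f p.1 p.2.

Definition bilin (W : lmodType K) (f : U -> V -> W) : Prop :=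
  (forall v, linear (f^~ v)) /\ (forall u, linear (f u)).

Section TliftTheory.
Variables (W : lmodType K) (f : U -> V -> W).
Hypothesis f_bilin : bilin f.

Lemma bilinDl u u' v : f (u + u') v = f u v + f u' v.
Proof. by case: f_bilin => h _; have := h v 1 u u'; rewrite !scale1r. Qed.

Lemma bilinDr u v v' : f u (v + v') = f u v + f u v'.
Proof. by case: f_bilin => _ h; have := h u 1 v v'; rewrite !scale1r. Qed.

Lemma bilin0l v : f 0 v = 0.
Proof. by apply: (addrI (f 0 v)); rewrite -bilinDl !addr0. Qed.

Lemma bilin0r u : f u 0 = 0.
Proof. by apply: (addrI (f u 0)); rewrite -bilinDr !addr0. Qed.

Lemma bilinZl k u v : f (k *: u) v = k *: f u v.
Proof.
by case: f_bilin => h _; have := h v k u 0; rewrite bilin0l !addr0.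
Qed.

Lemma bilinZr k u v : f u (k *: v) = k *: f u v.
Proof.
by case: f_bilin => _ h; have := h u k v 0; rewrite bilin0r !addr0.
Qed.

Lemma tens_eq_sum s t : tens_eq s t ->
  \sum_(p <- s) f p.1 p.2 = \sum_(p <- t) f p.1 p.2.
Proof.
elim=> {s t} //.
- by move=> s t r _ -> _ ->.
- by move=> s s' t t' _ h1 _ h2; rewrite !big_cat /= h1 h2.
- by move=> s t; rewrite !big_cat /= addrC.
- by move=> v; rewrite big_seq1 big_nil bilin0l.
- by move=> u u' v; rewrite big_seq1 big_cons big_seq1 /= bilinDl.
- by move=> u v v'; rewrite big_seq1 big_cons big_seq1 /= bilinDr.
- by move=> k u v; rewrite !big_seq1 /= bilinZl bilinZr.
Qed.

Lemma tlift_pi s : tlift f (\pi s) = \sum_(p <- s) f p.1 p.2.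
Proof. exact/tens_eq_sum/tens_repr. Qed.

Lemma tliftE u v : tlift f (pure_tensor u v) = f u v.
Proof. by rewrite /pure_tensor tlift_pi big_seq1. Qed.

Lemma tlift_linear : linear (tlift f).
Proof.
move=> k; elim/quotW=> s; elim/quotW=> t.
rewrite tens_pi_scale tens_pi_add !tlift_pi big_cat /= big_map scaler_sumr.
by congr (_ + _); apply: eq_bigr => p _ /=; rewrite bilinZl.
Qed.

End TliftTheory.

Lemma pure_tensor_bilin : bilin pure_tensor.
Proof.
split=> [v k u u'|u k v v']; rewrite tens_pi_scale tens_pi_add;
  apply/tens_piP => /=.
  exact: tens_addl.
apply: tens_trans (tens_addr _ _ _) _.
rewrite -cat1s -[X in tens_eq _ X]cat1s; apply: tens_cat; last exact: tens_refl.
exact/tens_sym/tens_scale.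
Qed.

Lemma tensorP (x : tensor) :
  exists s : seq (U * V), x = \sum_(p <- s) pure_tensor p.1 p.2.
Proof.
elim/quotW: x => s; exists s; elim: s => [|[u v] s IHs].
  by rewrite big_nil.
by rewrite big_cons -IHs tens_pi_add.
Qed.

End Tensor.

Arguments tensor {K} (U V)%_type.
Reserved Notation "x ⊗ y" (at level 40, left associativity).
Notation "U ⊗ V" := (tensor U V) : type_scope.
Notation "x ⊗ y" := (pure_tensor x y) : ring_scope.

(* [pres Rel] is the commutative K-algebra with generators [pgen x], x : X, and
   relations [p = q] for [Rel p q]: terms modulo the smallest congruence
   containing [Rel] and the axioms of commutative K-algebras. *)
Inductive pterm (K X : Type) : Type :=
| PGen of X
| PConst of K
| PAdd of pterm K X & pterm K X
| PMul of pterm K X & pterm K X.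
Arguments PGen {K X} _.
Arguments PConst {K X} _.
Arguments PAdd {K X} _ _.
Arguments PMul {K X} _ _.

HB.instance Definition _ (K X : Type) := gen_eqMixin (pterm K X).
HB.instance Definition _ (K X : Type) := gen_choiceMixin (pterm K X).

Section Presentation.
Variables (K : fieldType) (X : Type) (Rel : pterm K X -> pterm K X -> Prop).
Implicit Types p q r : pterm K X.

Inductive peq : pterm K X -> pterm K X -> Prop :=
| peq_refl p : peq p p
| peq_sym p q : peq p q -> peq q p
| peq_trans p q r : peq p q -> peq q r -> peq p r
| peq_add p p' q q' : peq p p' -> peq q q' -> peq (PAdd p q) (PAdd p' q')
| peq_mul p p' q q' : peq p p' -> peq q q' -> peq (PMul p q) (PMul p' q')
| peq_addA p q r : peq (PAdd p (PAdd q r)) (PAdd (PAdd p q) r)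
| peq_addC p q : peq (PAdd p q) (PAdd q p)
| peq_add0 p : peq (PAdd (PConst 0) p) p
| peq_mulA p q r : peq (PMul p (PMul q r)) (PMul (PMul p q) r)
| peq_mulC p q : peq (PMul p q) (PMul q p)
| peq_mul1 p : peq (PMul (PConst 1) p) p
| peq_mul0 p : peq (PMul (PConst 0) p) (PConst 0)
| peq_mulDl p q r : peq (PMul (PAdd p q) r) (PAdd (PMul p r) (PMul q r))
| peq_constD a b : peq (PConst (a + b)) (PAdd (PConst a) (PConst b))
| peq_constM a b : peq (PConst (a * b)) (PMul (PConst a) (PConst b))
| peq_rel p q : Rel p q -> peq p q.

Definition peqb p q : bool := `[< peq p q >].

Lemma peqb_equiv : equiv_class_of peqb.
Proof.
split=> [s|s t|t s r]; first by apply/asboolP; apply: peq_refl.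
  by apply/asboolP/asboolP; apply: peq_sym.
by move=> /asboolP h1 /asboolP h2; apply/asboolP; apply: peq_trans h1 h2.
Qed.

Canonical peq_equiv := EquivRelPack peqb_equiv.
Canonical peq_encModRel := defaultEncModRel peqb.

Definition pres := {eq_quot peqb}.
HB.instance Definition _ : EqQuotient _ peqb pres := EqQuotient.on pres.
HB.instance Definition _ := Choice.on pres.

Lemma pres_piP p q : \pi_pres p = \pi_pres q <-> peq p q.
Proof. by split=> [/eqmodP/asboolP|h] //; apply/eqmodP/asboolP. Qed.

Lemma pres_repr p : peq (repr (\pi_pres p)) p.
Proof. by apply/pres_piP; rewrite reprK. Qed.

Definition pgen (x : X) : pres := \pi_pres (PGen x).
Definition pconst (k : K) : pres := \pi_pres (PConst k).
Definition pres_add (x y : pres) : pres := \pi_pres (PAdd (repr x) (repr y)).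
Definition pres_mul (x y : pres) : pres := \pi_pres (PMul (repr x) (repr y)).
Definition pres_opp (x : pres) : pres := pres_mul (pconst (- 1)) x.

Lemma pres_addE p q : pres_add (\pi p) (\pi q) = \pi_pres (PAdd p q).
Proof. by apply/pres_piP; apply: peq_add; apply: pres_repr. Qed.

Lemma pres_mulE p q : pres_mul (\pi p) (\pi q) = \pi_pres (PMul p q).
Proof. by apply/pres_piP; apply: peq_mul; apply: pres_repr. Qed.

Lemma pres_addA : associative pres_add.
Proof.
elim/quotW=> x; elim/quotW=> y; elim/quotW=> z; rewrite !pres_addE.
exact/pres_piP/peq_addA.
Qed.

Lemma pres_addC : commutative pres_add.
Proof.
by elim/quotW=> x; elim/quotW=> y; rewrite !pres_addE; apply/pres_piP/peq_addC.
Qed.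

Lemma pres_add0 : left_id (pconst 0) pres_add.
Proof. by elim/quotW=> x; rewrite !pres_addE; apply/pres_piP/peq_add0. Qed.

Lemma pres_mulA : associative pres_mul.
Proof.
elim/quotW=> x; elim/quotW=> y; elim/quotW=> z; rewrite !pres_mulE.
exact/pres_piP/peq_mulA.
Qed.

Lemma pres_mulC : commutative pres_mul.
Proof.
by elim/quotW=> x; elim/quotW=> y; rewrite !pres_mulE; apply/pres_piP/peq_mulC.
Qed.

Lemma pres_mul1 : left_id (pconst 1) pres_mul.
Proof. by elim/quotW=> x; rewrite !pres_mulE; apply/pres_piP/peq_mul1. Qed.

Lemma pres_mul0 : left_zero (pconst 0) pres_mul.
Proof. by elim/quotW=> x; rewrite !pres_mulE; apply/pres_piP/peq_mul0. Qed.

Lemma pres_mulDl : left_distributive pres_mul pres_add.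
Proof.
elim/quotW=> x; elim/quotW=> y; elim/quotW=> z.
by rewrite !(pres_mulE, pres_addE); apply/pres_piP/peq_mulDl.
Qed.

Lemma pres_constD a b : pconst (a + b) = pres_add (pconst a) (pconst b).
Proof. by rewrite pres_addE; apply/pres_piP/peq_constD. Qed.

Lemma pres_constM a b : pconst (a * b) = pres_mul (pconst a) (pconst b).
Proof. by rewrite pres_mulE; apply/pres_piP/peq_constM. Qed.

Lemma pres_addN : left_inverse (pconst 0) pres_opp pres_add.
Proof.
move=> x; rewrite /pres_opp -{2}[x]pres_mul1 -pres_mulDl -pres_constD.
by rewrite addNr pres_mul0.
Qed.

HB.instance Definition _ :=
  GRing.isZmodule.Build pres pres_addA pres_addC pres_add0 pres_addN.
HB.instance Definition _ := GRing.Zmodule_isComPzRing.Build pres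
  pres_mulA pres_mulC pres_mul1 pres_mulDl.

(* [pres] may be the zero ring, hence it is not declared as an [algType]. *)
Definition pres_scl (k : K) (x : pres) : pres := pconst k * x.

Lemma pres_sclA a b x : pres_scl a (pres_scl b x) = pres_scl (a * b) x.
Proof.
rewrite /pres_scl mulrA; congr (_ * _).
by rewrite pres_constM.
Qed.

Lemma pres_scl1 : left_id 1 pres_scl.
Proof. exact: pres_mul1. Qed.

Lemma pres_sclDr : right_distributive pres_scl +%R.
Proof. by move=> a x y; rewrite /pres_scl mulrDr. Qed.

Lemma pres_sclDl x : {morph pres_scl^~ x : a b / a + b}.
Proof. by move=> a b; rewrite /pres_scl pres_constD mulrDl. Qed.

HB.instance Definition _ := GRing.Zmodule_isLmodule.Build K pres
  pres_sclA pres_scl1 pres_sclDr pres_sclDl.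

Lemma pres_scaleE (k : K) (x : pres) : k *: x = pconst k * x.
Proof. by []. Qed.

Lemma pres_scalerAl (k : K) (x y : pres) : k *: (x * y) = (k *: x) * y.
Proof. by rewrite !pres_scaleE mulrA. Qed.

Lemma pconst_is_zmod_morphism : zmod_morphism pconst.
Proof.
move=> a b; apply: (addIr (pconst b)); rewrite subrK.
by rewrite [LHS](esym (pres_constD _ _)) subrK.
Qed.

Lemma pconst_is_monoid_morphism : monoid_morphism pconst.
Proof. by split=> // a b; rewrite pres_constM. Qed.

HB.instance Definition _ :=
  GRing.isZmodMorphism.Build K pres pconst pconst_is_zmod_morphism.
HB.instance Definition _ :=
  GRing.isMonoidMorphism.Build K pres pconst pconst_is_monoid_morphism.

Lemma pres_addpE p q : \pi_pres (PAdd p q) = \pi_pres p + \pi_pres q.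
Proof. by rewrite [RHS]/GRing.add /= pres_addE. Qed.

Lemma pres_mulpE p q : \pi_pres (PMul p q) = \pi_pres p * \pi_pres q.
Proof. by rewrite [RHS]/GRing.mul /= pres_mulE. Qed.

(* The endomorphism and the derivation of [pres] with prescribed values [f] on
   the generators, computed on an arbitrary representative; [pres_endoP] and
   [pres_derP] give the conditions on [f] under which they are well defined. *)
Section Endo.
Variable f : X -> pres.

Fixpoint pterm_eval p : pres :=
  match p with
  | PGen x => f x
  | PConst k => pconst k
  | PAdd p q => pterm_eval p + pterm_eval q
  | PMul p q => pterm_eval p * pterm_eval q
  end.

Fixpoint pterm_der p : pres :=
  match p with
  | PGen x => f x
  | PConst k => 0
  | PAdd p q => pterm_der p + pterm_der q
  | PMul p q => pterm_der p * \pi_pres q + \pi_pres p * pterm_der q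
  end.

Definition pres_endo (x : pres) : pres := pterm_eval (repr x).
Definition pres_der (x : pres) : pres := pterm_der (repr x).

Hypothesis f_rel : forall p q, Rel p q -> pterm_eval p = pterm_eval q.

Lemma pterm_eval_eq p q : peq p q -> pterm_eval p = pterm_eval q.
Proof.
elim=> {p q} //=.
- by move=> p q r _ -> _ ->.
- by move=> p p' q q' _ -> _ ->.
- by move=> p p' q q' _ -> _ ->.
- by move=> p q r; rewrite addrA.
- by move=> p q; rewrite addrC.
- by move=> p; rewrite add0r.
- by move=> p q r; rewrite mulrA.
- by move=> p q; rewrite mulrC.
- by move=> p; rewrite mul1r.
- by move=> p; rewrite mul0r.
- by move=> p q r; rewrite mulrDl.
- by move=> a b; rewrite -pres_addpE; apply/pres_piP/peq_constD.
- by move=> a b; rewrite -pres_mulpE; apply/pres_piP/peq_constM.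
Qed.

Lemma pterm_eval_sum (I : Type) (r : seq I) (F : I -> pterm K X) :
  pterm_eval (\big[PAdd/PConst 0]_(i <- r) F i) = \sum_(i <- r) pterm_eval (F i).
Proof. by elim: r => [|i r IHr]; rewrite ?big_nil // !big_cons /= IHr. Qed.

Lemma pres_endo_pi p : pres_endo (\pi p) = pterm_eval p.
Proof. exact/pterm_eval_eq/pres_repr. Qed.

Lemma pres_endoP :
  [/\ linear pres_endo, forall x y, pres_endo (x * y) = pres_endo x * pres_endo y,
      pres_endo 1 = 1 & forall x, pres_endo (pgen x) = f x].
Proof.
have endoM x y : pres_endo (x * y) = pres_endo x * pres_endo y.
  elim/quotW: x => p; elim/quotW: y => q.
  by rewrite -pres_mulpE !pres_endo_pi.
split=> //; last 2 first.
- by rewrite [LHS](pres_endo_pi (PConst 1)).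
- by move=> x; rewrite pres_endo_pi.
move=> k x y; elim/quotW: x => p; elim/quotW: y => q.
by rewrite !pres_scaleE -pres_mulpE -pres_addpE !pres_endo_pi.
Qed.

End Endo.

Section Der.
Variable f : X -> pres.
Hypothesis f_rel : forall p q, Rel p q -> pterm_der f p = pterm_der f q.

Lemma pterm_der_eq p q : peq p q -> pterm_der f p = pterm_der f q.
Proof.
elim=> {p q} //=.
- by move=> p q r _ -> _ ->.
- by move=> p p' q q' _ -> _ ->.
- by move=> p p' q q' /pres_piP-> -> /pres_piP-> ->.
- by move=> p q r; rewrite addrA.
- by move=> p q; rewrite addrC.
- by move=> p; rewrite add0r.
- move=> p q r; rewrite !pres_mulpE !mulrDl !mulrDr !mulrA !addrA.
  by rewrite ![_ * pterm_der f _]mulrC.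
- by move=> p q; rewrite addrC; congr (_ + _); rewrite mulrC.
- by move=> p; rewrite mul0r add0r [_ * _]mul1r.
- by move=> p; rewrite mul0r add0r [_ * _]mul0r.
- move=> p q r; rewrite !pres_addpE !mulrDl -!addrA; congr (_ + _).
  by rewrite addrCA.
- by move=> a b; rewrite addr0.
- by move=> a b; rewrite mul0r mulr0 addr0.
Qed.

Lemma pterm_der_sum (I : Type) (r : seq I) (F : I -> pterm K X) :
  pterm_der f (\big[PAdd/PConst 0]_(i <- r) F i) =
  \sum_(i <- r) pterm_der f (F i).
Proof. by elim: r => [|i r IHr]; rewrite ?big_nil // !big_cons /= IHr. Qed.

Lemma pres_der_pi p : pres_der f (\pi p) = pterm_der f p.
Proof. exact/pterm_der_eq/pres_repr. Qed.

Lemma pres_derP :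
  [/\ linear (pres_der f),
      forall x y, pres_der f (x * y) = pres_der f x * y + x * pres_der f y
    & forall x, pres_der f (pgen x) = f x].
Proof.
have derM x y : pres_der f (x * y) = pres_der f x * y + x * pres_der f y.
  elim/quotW: x => p; elim/quotW: y => q.
  by rewrite -pres_mulpE !pres_der_pi.
split=> //; last by move=> x; rewrite pres_der_pi.
move=> k x y; elim/quotW: x => p; elim/quotW: y => q.
rewrite !pres_scaleE -pres_mulpE -pres_addpE !pres_der_pi /=.
by rewrite mul0r add0r.
Qed.

End Der.

End Presentation.

Section Hopf.
Variables (K : fieldType) (H : algType K).
Variables (Delta : {linear H -> tensor H H}) (eps : {scalar H}).
Variables (S : {linear H -> H}) (rho : H -> H -> H).

Definition finitely_generated_alg : Prop :=
  exists s : seq H, forall P : H -> Prop,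
    {in s, forall x, P x} -> (forall k : K, P k%:A) ->
    (forall x y, P x -> P y -> P (x + y)) ->
    (forall x y, P x -> P y -> P (x * y)) -> forall x, P x.

(* (Delta (x) id) \o Delta *)
Definition Delta2 (a : H) : H ⊗ (H ⊗ H) :=
  tlift (fun x a3 => tlift (fun a1 a2 => a1 ⊗ (a2 ⊗ a3)) (Delta x)) (Delta a).

Record cocommutative_hopf : Prop := {
  hopf_comul1 : Delta 1 = 1 ⊗ 1;
  hopf_comulM : forall a b, Delta (a * b) =
    tlift (fun a1 a2 => tlift (fun b1 b2 => (a1 * b1) ⊗ (a2 * b2)) (Delta b))
          (Delta a);
  hopf_counit1 : eps 1 = 1;
  hopf_counitM : forall a b, eps (a * b) = eps a * eps b;
  hopf_coassoc : forall a,
    Delta2 a = tlift (fun a1 y => a1 ⊗ Delta y) (Delta a);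
  hopf_counitl : forall a, tlift (fun a1 a2 => eps a1 *: a2) (Delta a) = a;
  hopf_counitr : forall a, tlift (fun a1 a2 => eps a2 *: a1) (Delta a) = a;
  hopf_antipodel : forall a, tlift (fun a1 a2 => S a1 * a2) (Delta a) = (eps a)%:A;
  hopf_antipoder : forall a, tlift (fun a1 a2 => a1 * S a2) (Delta a) = (eps a)%:A;
  hopf_cocomm : forall a, tlift (fun a1 a2 => a2 ⊗ a1) (Delta a) = Delta a
}.

Record fox_pairing : Prop := {
  fox_bilin : bilin rho;
  fox_Ml : forall a b c, rho (a * b) c = eps b *: rho a c + a * rho b c;
  fox_Mr : forall a b c, rho a (b * c) = rho a b * c + eps b *: rho a c
}.

Definition fox_transpose (a b : H) : H := S (rho (S b) (S a)).

Definition fox_antisymmetric : Prop := forall a b, fox_transpose a b = - rho a b.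

Definition dbracket (a b : H) : H ⊗ H :=
  tlift (fun a1 a2 => tlift (fun b1 b2 =>
    tlift (fun r1 r2 => (b1 * S r1 * a1) ⊗ r2) (Delta (rho a2 b2)))
  (Delta b)) (Delta a).

Definition tlift3 (W : lmodType K) (f : H -> H -> H -> W) (t : H ⊗ (H ⊗ H)) : W :=
  tlift (fun x u => tlift (f x) u) t.

Definition triF (a b c : H) : H ⊗ (H ⊗ H) :=
  tlift (fun a1 a2 => tlift (fun b1 b2 => tlift (fun c1 c2 =>
    tlift3 (fun r1 r2 r3 =>
      tlift (fun u1 u2 => (b1 * S r1 * a1) ⊗ ((c1 * S u1 * r2) ⊗ u2))
            (Delta (rho r3 c2)))
      (Delta2 (rho a2 b2)))
  (Delta c)) (Delta b)) (Delta a).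

(* tau_(123)^-1, where tau_(123) maps x (x) y (x) z to z (x) x (x) y *)
Definition tau123V (t : H ⊗ (H ⊗ H)) : H ⊗ (H ⊗ H) :=
  tlift3 (fun x y z => y ⊗ (z ⊗ x)) t.

Definition tritensor (a b c : H) : H ⊗ (H ⊗ H) :=
  triF a b c + tau123V (triF c a b) + tau123V (tau123V (triF b c a)).

Definition quasi_poisson_fox : Prop := forall x y z : H,
  tritensor x y z = 4%:R^-1 *:
    (1 ⊗ (y ⊗ (x * z)) + (y * x) ⊗ (1 ⊗ z)
     + x ⊗ ((z * y) ⊗ 1) + y ⊗ (z ⊗ x)
     - 1 ⊗ ((z * y) ⊗ x) - y ⊗ (1 ⊗ (x * z))
     - (y * x) ⊗ (z ⊗ 1) - x ⊗ (y ⊗ z)).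

End Hopf.

(* The generator a_ij of the representation algebra is encoded by (a, i, j). *)
Section TwistedRepresentations.
Variables (K : fieldType) (H : algType K) (S : H -> H) (N : nat).
Variables (sgn : 'I_N -> K) (tau : 'I_N -> 'I_N).

Local Notation T := (pterm K (H * 'I_N * 'I_N)).

Inductive rep_rel : T -> T -> Prop :=
| rep_add a b i j :
    rep_rel (PGen (a + b, i, j)) (PAdd (PGen (a, i, j)) (PGen (b, i, j)))
| rep_scale k a i j :
    rep_rel (PGen (k *: a, i, j)) (PMul (PConst k) (PGen (a, i, j)))
| rep_mul a b i j :
    rep_rel (PGen (a * b, i, j))
      (\big[PAdd/PConst 0]_(r < N) PMul (PGen (a, i, r)) (PGen (b, r, j)))
| rep_one i j : rep_rel (PGen (1, i, j)) (PConst (i == j)%:R).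

Inductive twrep_rel : T -> T -> Prop :=
| twrep_rep p q : rep_rel p q -> twrep_rel p q
| twrep_twist a i j :
    twrep_rel (PGen (S a, i, j))
      (PMul (PConst (sgn i * sgn j)) (PGen (a, tau j, tau i))).

Definition twrep : Type := pres twrep_rel.
HB.instance Definition _ := GRing.ComPzRing.on twrep.
HB.instance Definition _ := GRing.Lmodule.on twrep.

Definition entry (a : H) (i j : 'I_N) : twrep := pgen twrep_rel (a, i, j).

Definition tconst (k : K) : twrep := pconst twrep_rel k.
HB.instance Definition _ := GRing.RMorphism.copy tconst (pconst twrep_rel).

Definition gen_mx (a : H) : 'M[twrep]_N := \matrix_(i, j) entry a i j.

Definition tentry (t : H ⊗ H) (k j i l : 'I_N) : twrep :=
  tlift (fun c d => entry c k j * entry d i l) t.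

Record biderivation (br : twrep -> twrep -> twrep) : Prop := {
  bider_linl : forall y, linear (br^~ y);
  bider_linr : forall x, linear (br x);
  bider_Ml : forall x y z, br (x * y) z = x * br y z + br x z * y;
  bider_Mr : forall x y z, br x (y * z) = br x y * z + y * br x z
}.

Definition antisymmetric_bracket (br : twrep -> twrep -> twrep) : Prop :=
  forall x y, br x y = - br y x.

Definition jacobiator (br : twrep -> twrep -> twrep) (f g h : twrep) : twrep :=
  br f (br g h) + br g (br h f) + br h (br f g).

Record poisson_bracket (br : twrep -> twrep -> twrep) : Prop := {
  poisson_bider : biderivation br;
  poisson_antisym : antisymmetric_bracket br;
  poisson_jacobi : forall f g h, jacobiator br f g h = 0
}.

(* G is the group of matrices preserving the bilinear form of matrix J. *)
Variable J : 'M[K]_N.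

Definition isometry_group (g : 'M[K]_N) : Prop :=
  g \in unitmx /\ g^T *m J *m g = J.

Definition isometry_lie : {vspace 'M[K]_N} :=
  lker (linfun (fun xi : 'M[K]_N => xi^T *m J + J *m xi)).

Lemma mem_isometry_lie (xi : 'M[K]_N) :
  (xi \in isometry_lie) = (xi^T *m J + J *m xi == 0).
Proof.
pose f (xi : 'M[K]_N) := xi^T *m J + J *m xi.
have f_lin : linear f.
  move=> k x y; rewrite /f raddfD /= linearZ /= mulmxDl mulmxDr.
  by rewrite -scalemxAl -scalemxAr scalerDr addrACA.
pose fL := GRing.isLinear.Build K 'M[K]_N 'M[K]_N *:%R f f_lin.
pose F : {linear 'M[K]_N -> 'M[K]_N} := HB.pack f fL.
by rewrite memv_ker (lfunE F).
Qed.

Definition const_gen_mx (g : 'M[K]_N) : 'M[twrep]_N :=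
  map_mx tconst g.

(* g . X(a) = g^-1 X(a) g and xi . X(a) = [X(a), xi] *)
Definition act (g : 'M[K]_N) : twrep -> twrep :=
  pres_endo (fun x => (const_gen_mx (invmx g) *m gen_mx x.1.1 *m const_gen_mx g)
                        x.1.2 x.2).

Definition inf_act (xi : 'M[K]_N) : twrep -> twrep :=
  pres_der (fun x => (gen_mx x.1.1 *m const_gen_mx xi
                      - const_gen_mx xi *m gen_mx x.1.1) x.1.2 x.2).

(* The two maps are well defined as soon as M |-> J M^T J^-1 is the twist: the
   hypotheses below hold in the orthogonal and in the symplectic case, see
   [orth_twist_form] and [symp_twist_form]. *)
Definition twist_form : Prop :=
  [/\ involutive tau, forall i, sgn i * sgn i = 1,
      exists e : K, e * e = 1 /\ forall i, sgn (tau i) = e * sgn i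
    & J = \matrix_(i, j) (sgn i *+ (j == tau i))].

Section WellDefined.
Hypothesis J_twist : twist_form.

Lemma pi_sum (I : Type) (r : seq I) (F : I -> T) :
  \pi_(pres twrep_rel) (\big[PAdd/PConst 0]_(i <- r) F i) =
  \sum_(i <- r) \pi_(pres twrep_rel) (F i).
Proof. by elim: r => [|i r IHr]; rewrite ?big_nil // !big_cons pres_addpE IHr. Qed.

Lemma pi_rel p q : twrep_rel p q ->
  \pi_(pres twrep_rel) p = \pi_(pres twrep_rel) q.
Proof. by move=> h; apply/pres_piP/peq_rel. Qed.

Lemma gen_mxD a b : gen_mx (a + b) = gen_mx a + gen_mx b.
Proof.
apply/matrixP=> i j; rewrite !mxE [LHS](pi_rel (twrep_rep (rep_add a b i j))).
by rewrite pres_addpE.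
Qed.

Lemma gen_mxZ k a : gen_mx (k *: a) = tconst k *: gen_mx a.
Proof.
apply/matrixP=> i j; rewrite !mxE [LHS](pi_rel (twrep_rep (rep_scale k a i j))).
by rewrite pres_mulpE.
Qed.

Lemma gen_mxM a b : gen_mx (a * b) = gen_mx a *m gen_mx b.
Proof.
apply/matrixP=> i j; rewrite !mxE [LHS](pi_rel (twrep_rep (rep_mul a b i j))).
by rewrite pi_sum; apply: eq_bigr => r _; rewrite !mxE pres_mulpE.
Qed.

Lemma gen_mx1 : gen_mx 1 = 1%:M.
Proof.
apply/matrixP=> i j; rewrite !mxE [LHS](pi_rel (twrep_rep (rep_one i j))).
by rewrite -(rmorph_nat tconst).
Qed.

Lemma twistP (B B' : 'M[twrep]_N) :
  B' *m const_gen_mx J = const_gen_mx J *m B^T <->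
  forall i j, B' i j = tconst (sgn i * sgn j) * B (tau j) (tau i).
Proof.
case: J_twist => tauK sgnK [e [eK sgn_tau]] JE.
have constM := rmorphM tconst.
have lE i k : (B' *m const_gen_mx J) i k =
    B' i (tau k) * tconst (e * sgn k).
  rewrite mxE (bigD1 (tau k)) //= big1 ?addr0 => [|j jk]; rewrite JE !mxE.
    by rewrite tauK eqxx sgn_tau.
  case: eqP => [kE|_]; first by rewrite kE tauK eqxx in jk.
  by rewrite rmorph0 mulr0.
have rE i k : (const_gen_mx J *m B^T) i k = tconst (sgn i) * B k (tau i).
  rewrite mxE (bigD1 (tau i)) //= big1 ?addr0 => [|j ji]; rewrite JE !mxE.
    by rewrite eqxx.
  by rewrite (negbTE ji) rmorph0 mul0r.
split=> [h i j|h].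
  have /matrixP/(_ i (tau j)) := h; rewrite lE rE tauK sgn_tau mulrA eK mul1r.
  move=> /(congr1 ( *%R^~ (tconst (sgn j)))).
  rewrite -mulrA -constM sgnK rmorph1 mulr1 => ->.
  by rewrite mulrAC -constM.
apply/matrixP=> i k; rewrite lE rE h tauK mulrAC -constM sgn_tau.
by rewrite -mulrA mulrACA eK sgnK !mulr1.
Qed.

Lemma gen_mx_twist a :
  gen_mx (S a) *m const_gen_mx J = const_gen_mx J *m (gen_mx a)^T.
Proof.
apply/twistP=> i j; rewrite !mxE [LHS](pi_rel (twrep_twist a i j)).
by rewrite pres_mulpE.
Qed.

Lemma twist_form_sq : exists e : K, e * e = 1 /\ J *m J = e%:M.
Proof.
case: J_twist => tauK sgnK [e [eK sgn_tau]] JE; exists e; split=> //.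
apply/matrixP=> i k; rewrite mxE (bigD1 (tau i)) //= big1 ?addr0.
  rewrite JE !mxE eqxx tauK sgn_tau mulrnAr mulrCA sgnK mulr1.
  by rewrite eq_sym.
by move=> j ji; rewrite JE !mxE (negbTE ji) mul0r.
Qed.

Lemma act_well_defined (g : 'M[K]_N) : isometry_group g ->
  [/\ linear (act g), forall x y, act g (x * y) = act g x * act g y, act g 1 = 1
    & forall a, map_mx (act g) (gen_mx a) =
                const_gen_mx (invmx g) *m gen_mx a *m const_gen_mx g].
Proof.
case=> gU gJ; pose f (x : H * 'I_N * 'I_N) :=
  (const_gen_mx (invmx g) *m gen_mx x.1.1 *m const_gen_mx g) x.1.2 x.2.
pose cg := const_gen_mx g; pose cV := const_gen_mx (invmx g).
pose Y a := cV *m gen_mx a *m cg.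
have fE a i j : f (a, i, j) = Y a i j by [].
have cM A B : const_gen_mx (A *m B) = const_gen_mx A *m const_gen_mx B.
  exact: map_mxM.
have cVg : cV *m cg = 1%:M by rewrite -cM mulVmx // /const_gen_mx map_mx1.
have cgV : cg *m cV = 1%:M by rewrite -cM mulmxV // /const_gen_mx map_mx1.
have ctr A : (const_gen_mx A)^T = const_gen_mx A^T by rewrite /const_gen_mx map_trmx.
have [e [eK JJ]] := twist_form_sq.
have gJ' : g *m J *m g^T = J.
  have JV : (e *: J) *m J = 1%:M.
    by rewrite -scalemxAl JJ scale_scalar_mx eK.
  have /mulmx1C : g^T *m (J *m g *m (e *: J)) = 1%:M.
    by rewrite !mulmxA gJ -(mulmx1C JV).
  move=> h; have := congr1 (mulmx (e *: J)) h.
  rewrite !mulmxA JV mul1mx mulmx1 -scalemxAr -scalemxAl.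
  by move=> /(congr1 ( *:%R e)); rewrite !scalerA eK !scale1r.
have Ytw a : Y (S a) *m const_gen_mx J = const_gen_mx J *m (Y a)^T.
  have e1 : cg *m const_gen_mx J = const_gen_mx J *m cV^T.
    rewrite -{2}gJ' !cM -!mulmxA -ctr -trmx_mul.
    by rewrite cVg trmx1 mulmx1.
  have e2 : cV *m const_gen_mx J = const_gen_mx J *m cg^T.
    rewrite -{1}gJ' !cM !mulmxA cVg mul1mx ctr.
    by [].
  rewrite /Y -mulmxA e1 !trmx_mul !mulmxA -(mulmxA cV) gen_mx_twist.
  by rewrite !mulmxA e2.
have frel p q : twrep_rel p q -> pterm_eval f p = pterm_eval f q.
  case=> {p q} [p q [a b i j|k a i j|a b i j|i j]|a i j] /=.
  - by rewrite !fE /Y gen_mxD mulmxDr mulmxDl mxE.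
  - by rewrite !fE /Y gen_mxZ -scalemxAr -scalemxAl mxE.
  - rewrite pterm_eval_sum fE.
    have -> : Y (a * b) = Y a *m Y b.
      rewrite /Y gen_mxM !mulmxA; congr (_ *m _ *m _).
      by rewrite -[_ *m cg *m cV]mulmxA cgV mulmx1.
    by rewrite mxE.
  - rewrite fE /Y gen_mx1 mulmx1 cVg mxE -(rmorph_nat tconst).
    by [].
  - by rewrite !fE; apply: (twistP _ _).1.
have [h1 h2 h3 h4] := pres_endoP frel.
split=> // a; apply/matrixP=> i j; rewrite [LHS]mxE [gen_mx a i j]mxE.
exact: h4.
Qed.

Lemma inf_act_well_defined (xi : 'M[K]_N) : xi \in isometry_lie ->
  [/\ linear (inf_act xi),
      forall x y, inf_act xi (x * y) = inf_act xi x * y + x * inf_act xi y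
    & forall a, map_mx (inf_act xi) (gen_mx a) =
                gen_mx a *m const_gen_mx xi - const_gen_mx xi *m gen_mx a].
Proof.
rewrite mem_isometry_lie => /eqP xiJ; pose f (x : H * 'I_N * 'I_N) :=
  (gen_mx x.1.1 *m const_gen_mx xi - const_gen_mx xi *m gen_mx x.1.1) x.1.2 x.2.
pose cx := const_gen_mx xi; pose Y a := gen_mx a *m cx - cx *m gen_mx a.
have fE a i j : f (a, i, j) = Y a i j by [].
have cM A B : const_gen_mx (A *m B) = const_gen_mx A *m const_gen_mx B.
  exact: map_mxM.
have ctr A : (const_gen_mx A)^T = const_gen_mx A^T by rewrite /const_gen_mx map_trmx.
have e1 : const_gen_mx J *m cx = - (cx^T *m const_gen_mx J).
  by apply/eqP; rewrite -addr_eq0 ctr -!cM -map_mxD addrC xiJ map_mx0.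
have e2 : cx *m const_gen_mx J = - (const_gen_mx J *m cx^T).
  have [e [eK JJ]] := twist_form_sq.
  have : J *m (xi^T *m J + J *m xi) *m J = 0 by rewrite xiJ mulmx0 mul0mx.
  rewrite mulmxDr mulmxDl !mulmxA JJ -!mulmxA JJ mul_mx_scalar mul_scalar_mx.
  rewrite -scalemxAr -scalerDr => /(congr1 ( *:%R e)).
  rewrite scalerA eK scale1r scaler0 addrC => /eqP.
  by rewrite addr_eq0 ctr -!cM -map_mxN => /eqP->.
have Ytw a : Y (S a) *m const_gen_mx J = const_gen_mx J *m (Y a)^T.
  rewrite /Y mulmxBl -!mulmxA e2 gen_mx_twist !mulmxN mulmxA gen_mx_twist.
  rewrite mulmxA e2 mulNmx raddfB /= !trmx_mul mulmxBr !mulmxA.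
  by rewrite opprK addrC.
have frel p q : twrep_rel p q -> pterm_der f p = pterm_der f q.
  case=> {p q} [p q [a b i j|k a i j|a b i j|i j]|a i j] /=.
  - rewrite !fE /Y gen_mxD mulmxDr mulmxDl opprD addrACA mxE.
    by [].
  - rewrite !fE /Y gen_mxZ -scalemxAr -scalemxAl -scalerBr mxE.
    by rewrite mul0r add0r.
  - rewrite pterm_der_sum fE.
    have -> : Y (a * b) = Y a *m gen_mx b + gen_mx a *m Y b.
      rewrite /Y gen_mxM !(mulmxBl, mulmxBr) !mulmxA.
      by rewrite [RHS]addrC addrA subrK.
    rewrite !mxE -big_split; apply: eq_bigr => r _.
    by rewrite [gen_mx b _ _]mxE [gen_mx a _ _]mxE.
  - by rewrite fE /Y gen_mx1 mulmx1 mul1mx subrr mxE.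
  - rewrite !fE mul0r add0r; exact: (twistP _ _).1.
have [h1 h2 h4] := pres_derP frel.
split=> // a; apply/matrixP=> i j; rewrite [LHS]mxE [gen_mx a i j]mxE.
exact: h4.
Qed.

End WellDefined.

Local Notation d := (\dim isometry_lie).

Definition dual_bases (F F' : d.-tuple 'M[K]_N) : Prop :=
  [/\ basis_of isometry_lie F, basis_of isometry_lie F'
    & forall a b : 'I_d, \tr (tnth F a *m tnth F' b) = (a == b)%:R].

Definition tri_wedge (xi : 'I_3 -> 'M[K]_N) (f g h : twrep) : twrep :=
  \sum_(s : 'S_3) ((-1) ^+ s : K) *:
    (inf_act (xi (s 0)) f * inf_act (xi (s 1)) g * inf_act (xi (s 2)) h).

Definition cartan_triderivation (F F' : d.-tuple 'M[K]_N) (f g h : twrep) :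
    twrep :=
  12%:R^-1 *: \sum_(a < d) \sum_(b < d) \sum_(c < d)
    \tr (tnth F' a *m (tnth F' b *m tnth F' c - tnth F' c *m tnth F' b)) *:
    tri_wedge (tnth [tuple tnth F a; tnth F b; tnth F c]) f g h.

(* The trace form is nondegenerate on o_N and sp_N, so dual bases exist, and the
   triderivation does not depend on them. *)
Record quasi_poisson_bracket (br : twrep -> twrep -> twrep) : Prop := {
  qpoisson_bider : biderivation br;
  qpoisson_antisym : antisymmetric_bracket br;
  qpoisson_inv : forall g, isometry_group g ->
    forall x y, br (act g x) (act g y) = act g (br x y);
  qpoisson_jacobi : forall F F', dual_bases F F' -> forall f g h,
    jacobiator br f g h = 2%:R^-1 *: cartan_triderivation F F' f g h
}.

End TwistedRepresentations.

Arguments entry {K H S N sgn tau} a i j.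
Arguments tentry {K H S N sgn tau} t k j i l.

Section Twists.
Variables (K : fieldType) (n : nat).

Definition orth_sgn (i : 'I_n) : K := 1.
Definition orth_tau (i : 'I_n) : 'I_n := i.
Definition orth_form : 'M[K]_n := 1%:M.

Definition symp_sgn (i : 'I_(n + n)) : K := if (i < n)%N then 1 else -1.
Definition symp_tau (i : 'I_(n + n)) : 'I_(n + n) :=
  match split i with inl k => rshift n k | inr k => lshift n k end.
Definition symp_form : 'M[K]_(n + n) := block_mx 0 1%:M (- 1%:M) 0.

Lemma orth_twist_form : twist_form orth_sgn orth_tau orth_form.
Proof.
split=> [i|i||] //; rewrite /orth_sgn ?mulr1 //.
  by exists 1; split=> [|i]; rewrite mulr1.
by apply/matrixP=> i j; rewrite !mxE eq_sym.
Qed.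

Lemma symp_sgn_tau i : symp_sgn (symp_tau i) = - symp_sgn i.
Proof.
rewrite /symp_sgn /symp_tau; case: (splitP i) => k kE /=.
  by rewrite ltnNge leq_addr.
by rewrite ltn_ord opprK.
Qed.

Lemma symp_twist_form : twist_form symp_sgn symp_tau symp_form.
Proof.
split.
- move=> i; rewrite {2}/symp_tau; case: splitP => k kE; apply/val_inj.
    by rewrite /symp_tau (unsplitK (inr k)).
  by rewrite /symp_tau (unsplitK (inl k)) /= kE.
- by move=> i; rewrite /symp_sgn; case: ifP => _; rewrite ?mulrNN mulr1.
- by exists (-1); split=> [|i]; rewrite ?mulrNN ?mulr1 // mulN1r symp_sgn_tau.
apply/matrixP=> i j; rewrite [RHS]mxE /symp_tau /symp_sgn /symp_form.
case: (splitP i) => k kE.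
  have -> : i = lshift n k by apply/val_inj.
  case: (splitP j) => l lE.
    have -> : j = lshift n l by apply/val_inj.
    by rewrite block_mxEul mxE eq_lrshift.
  have -> : j = rshift n l by apply/val_inj.
  by rewrite block_mxEur mxE eq_rshift /= eq_sym.
have -> : i = rshift n k by apply/val_inj.
case: (splitP j) => l lE.
  have -> : j = lshift n l by apply/val_inj.
  rewrite block_mxEdl !mxE eq_lshift /= eq_sym.
  by rewrite mulNrn.
have -> : j = rshift n l by apply/val_inj.
by rewrite block_mxEdr mxE eq_rlshift.
Qed.

End Twists.

Notation orth_rep S N := (twrep S (@orth_sgn _ N) (@orth_tau N)).
Notation symp_rep S n := (twrep S (@symp_sgn _ n) (@symp_tau n)).

(* Main.v *)
Require Import Defs.
From mathcomp Require Import all_boot all_order all_algebra.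
From mathcomp Require Import generic_quotient boolp ring.
From mathcomp Require Import reals complex.

(* The representation algebra of H carries the Van den Bergh bracket
   {a_ij, b_kl} = {{a, b}}_(kj, il), and the twist a_ij |-> S(a)^tau_ij is an
   involution preserving it because {{S a, S b}} = (S (x) S) {{a, b}} flipped.
   The twisted algebra is the coordinate ring of the fixed locus, and the bracket
   of the theorem is the reduction {f, g} = {f^+, g^+} with f^+ the invariant part
   of a lift f.  So its Jacobiator on generators is the average, over all ways of
   twisting the three arguments, of the Jacobiator upstairs.  The latter is
     ||c, b, a||_(kn, il, mj) - ||a, b, c||_(kj, ml, in),
   where only the antisymmetry of the double bracket is used.  In the quasi-Poisson
   case this is a quarter of the Cartan trivector of gl_N; averaging projects gl_N
   onto the Lie algebra of isometries, and expanding in dual bases gives psi. *)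

Set Implicit Arguments.
Unset Strict Implicit.
Unset Printing Implicit Defensive.

Import GRing.Theory.
Local Open Scope ring_scope.


(** * Linear maps out of tensor products *)

(** The untwisted representation algebra is never formed. Its bracket and iterated brackets are only
    written down on generators, with values already read in the twisted algebra. They are compatible
    with the twist because twisting all the arguments at once changes nothing ([gl_bracket_flip],
    [gl_double_flip]). For the same reason the average over the twists of all arguments but one is
    already the full average: the bracket on generators has two terms rather than four, its
    Jacobiator four rather than eight.

    The orthogonal and the symplectic case are one argument about [twist_form]. Signs enter through
    [sgn i * sgn i = 1] and through the constant [e] with [sgn (tau i) = e * sgn i]; as [e * e = 1],
    it disappears from every product of two signs.

    On the Hopf side everything is a Sweedler computation. Cocommutativity makes the antipode an
    involution commuting with the coproduct, so that twisting is an involution compatible with the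
    double bracket. *)

Section Linear.
Variable K : fieldType.
Implicit Types (U V W T : lmodType K) (E : algType K).

Section LinearProp.
Variables (U V : lmodType K) (f : U -> V).
Hypothesis fl : linear f.

Lemma linear_propD : {morph f : x y / x + y}.
Proof. by move=> x y; have := fl 1 x y; rewrite !scale1r. Qed.

Lemma linear_prop0 : f 0 = 0.
Proof. by apply: (addrI (f 0)); rewrite -linear_propD !addr0. Qed.

Lemma linear_propZ k x : f (k *: x) = k *: f x.
Proof. by rewrite -[k *: x]addr0 fl linear_prop0 addr0. Qed.

Lemma linear_propN x : f (- x) = - f x.
Proof. by rewrite -scaleN1r linear_propZ scaleN1r. Qed.

Lemma linear_prop_sum (I : Type) (r : seq I) (P : pred I) (F : I -> U) :
  f (\sum_(i <- r | P i) F i) = \sum_(i <- r | P i) f (F i).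
Proof. exact: (big_morph f linear_propD linear_prop0). Qed.

Lemma linear_tlift (U1 U2 : lmodType K) (F : U1 -> U2 -> U) t :
  f (tlift F t) = tlift (fun u v => f (F u v)) t.
Proof. exact: linear_prop_sum. Qed.

End LinearProp.

Lemma linear_id U : linear (fun x : U => x). Proof. by []. Qed.

Lemma linear_comp U V W (f : {linear V -> W}) (g : U -> V) :
  linear g -> linear (fun x => f (g x)).
Proof. by move=> gl k x y; rewrite gl linearP. Qed.

Lemma linear_compose U V W (f : V -> W) (g : U -> V) :
  linear f -> linear g -> linear (fun x => f (g x)).
Proof. by move=> fl gl k x y; rewrite gl fl. Qed.

Lemma linear_scale U V k (g : U -> V) : linear g -> linear (fun x => k *: g x).
Proof. by move=> gl c x y; rewrite gl scalerDr !scalerA mulrC. Qed.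

Lemma linear_scalel U V W (h : {scalar V}) (g : U -> V) (w : W) :
  linear g -> linear (fun x => h (g x) *: w).
Proof. by move=> gl c x y; rewrite gl linearP scalerDl scalerA. Qed.

Lemma linear_add U V (f g : U -> V) :
  linear f -> linear g -> linear (fun x => f x + g x).
Proof. by move=> fl gl c x y; rewrite fl gl scalerDr addrACA. Qed.

Lemma linear_opp U V (g : U -> V) : linear g -> linear (fun x => - g x).
Proof. by move=> gl c x y; rewrite gl scalerN opprD. Qed.

Lemma linear_mull U E (g : U -> E) (c : E) :
  linear g -> linear (fun x => g x * c).
Proof. by move=> gl k x y; rewrite gl mulrDl scalerAl. Qed.

Lemma linear_mulr U E (g : U -> E) (c : E) :
  linear g -> linear (fun x => c * g x).
Proof. by move=> gl k x y; rewrite gl mulrDr scalerAr. Qed.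

Lemma linear_pres_mull U (X : Type) (Rel : pterm K X -> pterm K X -> Prop)
    (g : U -> pres Rel) c : linear g -> linear (fun x => g x * c).
Proof. by move=> gl k x y; rewrite gl mulrDl pres_scalerAl. Qed.

Lemma linear_pres_mulr U (X : Type) (Rel : pterm K X -> pterm K X -> Prop)
    (g : U -> pres Rel) c : linear g -> linear (fun x => c * g x).
Proof. by move=> gl k x y; rewrite gl mulrDr !(mulrC c) pres_scalerAl. Qed.

Lemma linear_bill U V T W (f : V -> T -> W) (g : U -> V) v :
  bilin f -> linear g -> linear (fun x => f (g x) v).
Proof. by move=> [fl _] gl k x y; rewrite gl; apply: fl. Qed.

Lemma linear_bilr U V T W (f : V -> T -> W) (g : U -> T) v :
  bilin f -> linear g -> linear (fun x => f v (g x)).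
Proof. by move=> [_ fl] gl k x y; rewrite gl; apply: fl. Qed.

Lemma bilin_split U V W (f : U -> V -> W) :
  (forall v, linear (fun u => f u v)) -> (forall u, linear (fun v => f u v)) ->
  bilin f.
Proof. by []. Qed.

(** With [t] fixed, the sum runs over one representative and linearity in [x] passes through
    termwise. When the tensor itself varies, as in the next lemma, bilinearity is what makes the
    choice of representative irrelevant. *)
Lemma linear_tlift_fun T U V W (F : T -> U -> V -> W) t :
  (forall u v, linear (fun x => F x u v)) -> linear (fun x => tlift (F x) t).
Proof.
move=> Fl k x y; rewrite /tlift scaler_sumr -big_split /=.
by apply: eq_bigr => p _; rewrite Fl.
Qed.

Lemma linear_tlift_arg T U V W (f : U -> V -> W) (g : T -> U ⊗ V) :
  bilin f -> linear g -> linear (fun x => tlift f (g x)).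
Proof. by move=> fb gl k x y; rewrite gl; apply: tlift_linear. Qed.

Lemma eq_tlift U V W (f : U -> V -> W) (g : U -> V -> W) (t : U ⊗ V) :
  (forall u v, f u v = g u v) -> tlift f t = tlift g t.
Proof. by move=> fg; apply: eq_bigr. Qed.

Lemma tliftD U V W (f g : U -> V -> W) t :
  tlift (fun u v => f u v + g u v) t = tlift f t + tlift g t.
Proof. by rewrite /tlift big_split. Qed.

Lemma tliftN U V W (f : U -> V -> W) t :
  tlift (fun u v => - f u v) t = - tlift f t.
Proof. by rewrite /tlift sumrN. Qed.

Lemma tliftZ U V W k (f : U -> V -> W) t :
  tlift (fun u v => k *: f u v) t = k *: tlift f t.
Proof. by rewrite /tlift scaler_sumr. Qed.

Lemma tlift_sum U V W (I : Type) (r : seq I) (P : pred I) (F : I -> U -> V -> W) t :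
  tlift (fun u v => \sum_(i <- r | P i) F i u v) t = \sum_(i <- r | P i) tlift (F i) t.
Proof. exact: exchange_big. Qed.

Lemma tlift_exchange U V U' V' W (f : U -> V -> U' -> V' -> W) s t :
  tlift (fun u v => tlift (f u v) t) s =
  tlift (fun u' v' => tlift (fun u v => f u v u' v') s) t.
Proof. exact: exchange_big. Qed.

Lemma tlift_tlift U V U' V' W (f : U -> V -> W) (g : U' -> V' -> U ⊗ V) t :
  bilin f -> tlift f (tlift g t) = tlift (fun u v => tlift f (g u v)) t.
Proof. by move=> fb; apply: linear_tlift; apply: tlift_linear. Qed.

End Linear.

(** Linearity of a multilinear expression is found by descending to the occurrence of the variable;
    the alternatives under [first] select the factor that contains it. *)
Ltac lin_step :=
  cbv beta;
  lazymatch goal with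
  | |- bilin (@pure_tensor _ _ _) => apply pure_tensor_bilin
  | |- bilin _ => first
      [ match goal with h : bilin _ |- _ => exact: h end
      | apply bilin_split; intro ]
  | |- forall _, _ => intro
  | |- GRing.linear_for _ (fun x => x) => exact: linear_id
  | |- GRing.linear_for _ id => exact: linear_id
  | |- GRing.linear_for _ (fun x => tlift _ _) =>
      first [apply linear_tlift_fun | apply linear_tlift_arg]
  | |- GRing.linear_for _ (tlift _) => apply: tlift_linear
  | |- GRing.linear_for _ (fun x => _ * _) =>
      first [ apply linear_mull | apply linear_mulr
            | apply: linear_pres_mull | apply: linear_pres_mulr ]
  | |- GRing.linear_for _ ( *%R _) =>
      first [apply linear_mulr | apply: linear_pres_mulr]
  | |- GRing.linear_for _ (fun x => _ *: _) =>
      first [apply linear_scale | apply linear_scalel]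
  | |- GRing.linear_for _ (fun x => - _) => apply linear_opp
  | |- GRing.linear_for _ (fun x => _ + _) => apply linear_add
  | |- GRing.linear_for _ (fun x => _ ⊗ _) =>
      first [ apply: (linear_bill _ (@pure_tensor_bilin _ _ _))
            | apply: (linear_bilr _ (@pure_tensor_bilin _ _ _)) ]
  | |- GRing.linear_for _ (pure_tensor _) =>
      apply: (linear_bilr _ (@pure_tensor_bilin _ _ _))
  | _ => first
      [ match goal with h : linear _ |- _ => exact: h end
      | match goal with h : forall _, _ |- _ => apply h end
      | match goal with h : bilin _ |- _ =>
          first [apply: (linear_bill _ h) | apply: (linear_bilr _ h)] end
      | match goal with h : forall _ _, linear _ |- _ =>
          apply: (linear_compose (h _ _)) end
      | match goal with h : @GRing.Linear.type _ _ _ _ |- _ => exact: (linearP h) end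
      | match goal with h : @GRing.Linear.type _ _ _ _ |- _ => apply: (linear_comp h) end ]
  end.
Ltac lin := solve [repeat lin_step].

(** * Cocommutative Hopf algebras *)

Section HopfAlgebra.
Variables (K : fieldType) (H : algType K).
Variables (Delta : {linear H -> tensor H H}) (eps : {scalar H}).
Variables (S : {linear H -> H}).
Hypothesis hopf : cocommutative_hopf Delta eps S.
Implicit Types (W : lmodType K) (a b : H).

Local Notation "\Sw_ ( x , y 'of' a ) F" := (tlift (fun x y => F) (Delta a))
  (at level 41, x name, y name, a at level 35, F at level 41).

Lemma tlift_mul W (f : H -> H -> W) a b : bilin f ->
  \Sw_(x, y of a * b) f x y =
  \Sw_(a1, a2 of a) \Sw_(b1, b2 of b) f (a1 * b1) (a2 * b2).
Proof.
move=> fb; rewrite (hopf_comulM hopf) tlift_tlift //.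
apply: eq_tlift => a1 a2; rewrite tlift_tlift //.
by apply: eq_tlift => b1 b2; rewrite tliftE.
Qed.

Lemma tlift_comm W (f : H -> H -> W) a : bilin f ->
  \Sw_(x, y of a) f x y = \Sw_(x, y of a) f y x.
Proof.
move=> fb; rewrite -{1}(hopf_cocomm hopf a) tlift_tlift //.
by apply: eq_tlift => u v; rewrite tliftE.
Qed.

Lemma tlift_assoc W (f : H -> H -> H -> W) a :
  (forall y z, linear (fun x => f x y z)) ->
  (forall x z, linear (fun y => f x y z)) ->
  (forall x y, linear (fun z => f x y z)) ->
  \Sw_(x, a3 of a) \Sw_(a1, a2 of x) f a1 a2 a3 =
  \Sw_(a1, y of a) \Sw_(a2, a3 of y) f a1 a2 a3.
Proof.
move=> f1 f2 f3.
have := congr1 (tlift3 f) (hopf_coassoc hopf a); rewrite /Delta2 /tlift3.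
have fb : bilin (fun x u => tlift (f x) u) by lin.
rewrite !tlift_tlift //.
set L := tlift _ _; set R := tlift _ _ => LR.
have -> : \Sw_(a1, y of a) \Sw_(a2, a3 of y) f a1 a2 a3 = R.
  by apply: eq_tlift => u v; rewrite tliftE.
rewrite -LR; apply: eq_tlift => u v; rewrite tlift_tlift //.
by apply: eq_tlift => u' v'; rewrite tliftE // tliftE //; split; lin.
Qed.

Lemma tlift3_comul2 W (f : H -> H -> H -> W) a :
  (forall y z, linear (fun x => f x y z)) ->
  (forall x z, linear (fun y => f x y z)) ->
  (forall x y, linear (fun z => f x y z)) ->
  tlift3 f (Delta2 Delta a) =
  \Sw_(a1, y of a) \Sw_(a2, a3 of y) f a1 a2 a3.
Proof.
move=> f1 f2 f3; rewrite (hopf_coassoc hopf) /tlift3.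
have fb : bilin (fun x u => tlift (f x) u) by lin.
by rewrite tlift_tlift //; apply: eq_tlift => u v; rewrite tliftE.
Qed.

Lemma tlift_counitl W (g : H -> W) a : linear g ->
  \Sw_(x, y of a) (eps x *: g y) = g a.
Proof.
move=> gl; rewrite -{2}(hopf_counitl hopf a) linear_tlift //.
by apply: eq_tlift => x y; rewrite linear_propZ.
Qed.

Lemma tlift_counitr W (g : H -> W) a : linear g ->
  \Sw_(x, y of a) (eps y *: g x) = g a.
Proof.
move=> gl; rewrite -{2}(hopf_counitr hopf a) linear_tlift //.
by apply: eq_tlift => x y; rewrite linear_propZ.
Qed.

Section Cancel.
Variable m : H -> H -> H.
Hypothesis mb : bilin m.
Hypothesis m_unit : forall a, \Sw_(x, y of a) m x y = (eps a)%:A.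

Lemma tlift_unit W (g : H -> W) a : linear g ->
  \Sw_(x, y of a) g (m x y) = eps a *: g 1.
Proof. by move=> gl; rewrite -linear_tlift // m_unit linear_propZ. Qed.

(** The products [S x * y], [x * S y], [S y * x] and [y * S x] all satisfy [m_unit], the last two by
    cocommutativity; abstracting [m] covers the four cancellations at once. *)
Lemma tlift_cancel W (f : H -> H -> W) a : bilin f ->
  \Sw_(a1, y of a) \Sw_(a2, a3 of y) f (m a1 a2) a3 = f 1 a.
Proof.
move=> fb; rewrite -tlift_assoc; [|lin..].
rewrite -(@tlift_counitl _ (f 1) a); last lin.
by apply: eq_tlift => x y; rewrite (@tlift_unit _ (fun u => f u y)) //; lin.
Qed.

End Cancel.

Lemma unitSl : forall a, \Sw_(x, y of a) (S x * y) = (eps a)%:A.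
Proof. exact: hopf_antipodel. Qed.

Lemma unitSr : forall a, \Sw_(x, y of a) (x * S y) = (eps a)%:A.
Proof. exact: hopf_antipoder. Qed.

Lemma unitSlC : forall a, \Sw_(x, y of a) (S y * x) = (eps a)%:A.
Proof. by move=> a; rewrite -tlift_comm ?unitSl //; lin. Qed.

Lemma unitSrC : forall a, \Sw_(x, y of a) (y * S x) = (eps a)%:A.
Proof. by move=> a; rewrite -tlift_comm ?unitSr //; lin. Qed.

Lemma antipode1 : S 1 = 1.
Proof.
have := unitSl 1; rewrite (hopf_comul1 hopf) tliftE; last lin.
by rewrite mulr1 (hopf_counit1 hopf) scale1r.
Qed.

(** One Sweedler sum is evaluated in two ways: contracting [S (a1 * b1)] with [a2 * b2] leaves
    [S b * S a], while contracting [b2 * S b3] and then [a2 * S a3] leaves [S (a * b)]. *)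
Lemma antipodeM a b : S (a * b) = S b * S a.
Proof.
have h : \Sw_(a1, y of a) \Sw_(a2, a3 of y) \Sw_(b1, z of b) \Sw_(b2, b3 of z)
    (S (a1 * b1) * (a2 * b2 * S b3 * S a3)) = S b * S a.
  rewrite -tlift_assoc; [|lin..].
  transitivity (\Sw_(x, a3 of a) (eps x *: (S b * S a3))); last first.
    by rewrite tlift_counitl; last lin.
  apply: eq_tlift => x a3.
  transitivity (\Sw_(a1, a2 of x) \Sw_(w, b3 of b) \Sw_(b1, b2 of w)
    (S (a1 * b1) * (a2 * b2 * S b3 * S a3))).
    by apply: eq_tlift => a1 a2; rewrite tlift_assoc //; lin.
  rewrite tlift_exchange.
  transitivity (\Sw_(w, b3 of b) (eps w *: (eps x *: (S b3 * S a3)))).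
    apply: eq_tlift => w b3; rewrite scalerA mulrC -(hopf_counitM hopf).
    rewrite -[S b3 * S a3]mul1r.
    rewrite -(tlift_unit unitSl (g := fun u => u * (S b3 * S a3))); last lin.
    rewrite tlift_mul; last lin.
    apply: eq_tlift => a1 a2; apply: eq_tlift => b1 b2.
    by rewrite !mulrA.
  by rewrite tlift_counitl; last lin.
rewrite -h.
transitivity (\Sw_(a1, y of a) \Sw_(a2, a3 of y) (S (a1 * b) * (a2 * S a3))).
  transitivity (\Sw_(a1, y of a) (eps y *: S (a1 * b))).
    by rewrite (tlift_counitr (g := fun u => S (u * b))) //; lin.
  apply: eq_tlift => a1 y; rewrite -{1}[S _]mulr1.
  by rewrite (tlift_unit unitSr (g := fun u => S (a1 * b) * u)) //; lin.
apply: eq_tlift => a1 y; apply: eq_tlift => a2 a3.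
transitivity (\Sw_(b1, z of b) (eps z *: (S (a1 * b1) * (a2 * S a3)))).
  by rewrite (tlift_counitr (g := fun u => S (a1 * u) * (a2 * S a3))) //; lin.
apply: eq_tlift => b1 z; rewrite -[in LHS](mulr1 a2).
rewrite -(tlift_unit unitSr (g := fun u => S (a1 * b1) * (a2 * u * S a3))); last lin.
by apply: eq_tlift => b2 b3; rewrite !mulrA.
Qed.

(* Uniqueness of convolution inverses in Hom(H, E). *)
Lemma conv_inverse_uniq (E : lmodType K) (m : E -> E -> E) (e : E)
    (f g h : H -> E) :
  bilin m -> associative m -> left_id e m -> right_id e m ->
  linear f -> linear g -> linear h ->
  (forall a, \Sw_(x, y of a) m (f x) (g y) = eps a *: e) ->
  (forall a, \Sw_(x, y of a) m (g x) (h y) = eps a *: e) ->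
  forall a, f a = h a.
Proof.
move=> mb mA me1 me2 fl gl hl fg gh a.
rewrite -[h a](tlift_counitl a hl) -[f a](tlift_counitr a fl).
transitivity (\Sw_(a1, y of a) \Sw_(a2, a3 of y) m (f a1) (m (g a2) (h a3))).
  apply: eq_tlift => a1 y; rewrite -linear_tlift ?gh; last by lin.
  by rewrite (linear_propZ (mb.2 _)) me2.
rewrite -tlift_assoc; [|lin..].
apply: eq_tlift => x a3; rewrite -{2}[h a3]me1 -(linear_propZ (mb.1 _)) -fg.
rewrite (linear_tlift (mb.1 _)).
by apply: eq_tlift => a1 a2; rewrite mA.
Qed.

(** The double antipode and the identity are both convolution inverses of [S]. For the former,
    [S (S x) * S y] is [S (y * S x)], which contracts by cocommutativity. *)
Lemma antipodeK a : S (S a) = a.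
Proof.
apply: (@conv_inverse_uniq _ *%R 1 (fun x => S (S x)) S id) => //;
  try (by lin); try exact: mulrA; try exact: mul1r; try exact: mulr1.
- move=> b; rewrite -antipode1 -(linear_propZ (linearP S)) -unitSrC.
  rewrite (linear_tlift (linearP S)).
  by apply: eq_tlift => x y; rewrite antipodeM.
- exact: unitSl.
Qed.


(** The product of the algebra [H ⊗ H], which turns the linear maps from [H] to [H ⊗ H] into a
    convolution algebra. *)
Definition tmul (s t : H ⊗ H) : H ⊗ H :=
  tlift (fun p q => tlift (fun p' q' => (p * p') ⊗ (q * q')) t) s.

Lemma tmul_bilin : bilin tmul.
Proof. by rewrite /tmul; lin. Qed.

Lemma tmulE p q p' q' : tmul (p ⊗ q) (p' ⊗ q') = (p * p') ⊗ (q * q').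
Proof. by rewrite /tmul tliftE ?tliftE //; lin. Qed.

Lemma tensor_ind (P : H ⊗ H -> Prop) :
  P 0 -> (forall p q t, P t -> P (p ⊗ q + t)) -> forall t, P t.
Proof.
move=> P0 PD t; have [s ->] := tensorP t.
by elim: s => [|p s IHs]; rewrite ?big_nil // big_cons; apply: PD.
Qed.

Lemma tmul_ext (f g : H ⊗ H -> H ⊗ H) : linear f -> linear g ->
  (forall p q, f (p ⊗ q) = g (p ⊗ q)) -> f =1 g.
Proof.
move=> fl gl fg; elim/tensor_ind => [|p q t IHt].
  by rewrite !linear_prop0.
by rewrite !linear_propD // fg IHt.
Qed.

Lemma tmulA : associative tmul.
Proof.
have mb := tmul_bilin; move=> s t r.
move: s; apply: tmul_ext; [lin|lin|move=> s1 s2].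
move: t; apply: tmul_ext; [lin|lin|move=> t1 t2].
move: r; apply: tmul_ext; [lin|lin|move=> r1 r2].
by rewrite !tmulE !mulrA.
Qed.

Lemma tmul1 : left_id (1 ⊗ 1) tmul.
Proof.
have mb := tmul_bilin.
by apply: tmul_ext; [lin|lin|move=> t1 t2]; rewrite tmulE !mul1r.
Qed.

Lemma tmulr1 : right_id (1 ⊗ 1) tmul.
Proof.
have mb := tmul_bilin.
by apply: tmul_ext; [lin|lin|move=> t1 t2]; rewrite tmulE !mulr1.
Qed.

(** Both sides invert [Delta] under convolution. In general the antipode reverses the coproduct;
    cocommutativity allows the two factors to stay in order. *)
Lemma comul_antipode a : Delta (S a) = \Sw_(x, y of a) (S x ⊗ S y).
Proof.
have mb := tmul_bilin.
apply: (conv_inverse_uniq (f := fun a => Delta (S a)) (g := Delta)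
  (h := fun a => \Sw_(x, y of a) (S x ⊗ S y)) mb tmulA tmul1 tmulr1);
  try by lin.
- move=> {}a; rewrite -(hopf_comul1 hopf).
  rewrite -(tlift_unit unitSl (g := fun u => Delta u)); last lin.
  by apply: eq_tlift => x y; rewrite (hopf_comulM hopf).
- move=> {}a.
  transitivity (\Sw_(a1, y of a) \Sw_(p, q of a1) \Sw_(r, s of y)
                  ((p * S r) ⊗ (q * S s))).
    apply: eq_tlift => a1 y; rewrite {1}/tmul; apply: eq_tlift => p q.
    rewrite tlift_tlift; last lin.
    by apply: eq_tlift => r s; rewrite tliftE //; lin.
  rewrite (tlift_assoc (f := fun p q y => \Sw_(r, s of y) ((p * S r) ⊗ (q * S s))));
    try by lin.
  (* Cocommutativity exchanges the middle components [q] and [r], so that [q] stands next to [s] and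
     the right tensor factor contracts first. *)
  transitivity (\Sw_(p, y of a) \Sw_(r, z of y) \Sw_(q, s of z)
    ((p * S r) ⊗ (q * S s))).
    apply: eq_tlift => p y.
    rewrite -(tlift_assoc (f := fun q r s => (p * S r) ⊗ (q * S s))); try by lin.
    rewrite -(tlift_assoc (f := fun r q s => (p * S r) ⊗ (q * S s))); try by lin.
    apply: eq_tlift => w s.
    by rewrite tlift_comm; last lin.
  transitivity (\Sw_(p, y of a) \Sw_(r, z of y) (eps z *: ((p * S r) ⊗ (1 : H)))).
    apply: eq_tlift => p y; apply: eq_tlift => r z.
    by rewrite (tlift_unit unitSr (g := fun u => (p * S r) ⊗ u)); last lin.
  transitivity (\Sw_(p, r of a) ((p * S r) ⊗ (1 : H))).
    apply: eq_tlift => p y.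
    by rewrite (tlift_counitr (g := fun r => (p * S r) ⊗ (1 : H))); last lin.
  by rewrite (tlift_unit unitSr (g := fun u => u ⊗ 1)); last lin.
Qed.


(** * Fox pairings and their double brackets *)

Section FoxPairing.
Variable rho : H -> H -> H.
Hypothesis fox : fox_pairing eps rho.
Hypothesis anti : fox_antisymmetric S rho.
Let rho_bilin : bilin rho := fox_bilin fox.
Local Notation db := (dbracket Delta S rho).

Lemma fox1l b : rho 1 b = 0.
Proof.
have := fox_Ml fox 1 1 b; rewrite !mul1r (hopf_counit1 hopf) scale1r.
by move=> h; apply: (addrI (rho 1 b)); rewrite addr0 -h.
Qed.

Lemma fox1r a : rho a 1 = 0.
Proof.
have := fox_Mr fox a 1 1; rewrite !mulr1 (hopf_counit1 hopf) scale1r.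
by move=> h; apply: (addrI (rho a 1)); rewrite addr0 -h.
Qed.

(** [rho] vanishes on the unit, hence on the Sweedler sum of [S x * y]; the Leibniz rule splits that
    zero into the two sides. *)
Lemma foxSl a b : rho (S a) b = - \Sw_(x, y of a) (S x * rho y b).
Proof.
apply/eqP; rewrite -addr_eq0; apply/eqP.
rewrite -[in LHS](tlift_counitr (g := fun a => rho (S a) b) a); last lin.
rewrite -tliftD -[RHS](scaler0 _ (eps a)) -(fox1l b).
rewrite -(tlift_unit unitSl (g := fun a => rho a b)); last lin.
by apply: eq_tlift => x y; rewrite (fox_Ml fox).
Qed.

Lemma foxSr a b : rho a (S b) = - \Sw_(x, y of b) (rho a x * S y).
Proof.
apply/eqP; rewrite -addr_eq0; apply/eqP.
rewrite -[in LHS](tlift_counitl (g := fun b => rho a (S b)) b); last lin.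
rewrite addrC -tliftD -[RHS](scaler0 _ (eps b)) -(fox1r a).
rewrite -(tlift_unit unitSr (g := fun b => rho a b)); last lin.
by apply: eq_tlift => x y; rewrite (fox_Mr fox).
Qed.

(** Antisymmetry with the antipodes moved off the arguments of [rho]: [foxSl] and [foxSr] turn them
    into the outer factors. *)
Lemma fox_flip a b :
  rho a b = - \Sw_(a1, a2 of a) \Sw_(b1, b2 of b) (a1 * S (rho b2 a2) * b1).
Proof.
apply: oppr_inj; rewrite -anti opprK /fox_transpose foxSl.
rewrite (linear_propN (linearP S)) (linear_tlift (linearP S)) -tliftN.
rewrite tlift_exchange; apply: eq_tlift => b1 b2.
rewrite foxSr mulrN linearN opprK antipodeM antipodeK.
rewrite (linear_tlift (linearP S)) tlift_comm; last lin.
rewrite (linear_tlift (f := fun u => u * b1)); last lin.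
by apply: eq_tlift => a1 a2; rewrite antipodeM antipodeK.
Qed.

Lemma db_bilin : bilin db.
Proof. by rewrite /dbracket; lin. Qed.

Lemma tlift_pure (t : H ⊗ H) : tlift (fun p q => p ⊗ q) t = t.
Proof.
move: t; apply: tmul_ext; [by lin | by [] |] => p q.
by rewrite tliftE; last lin.
Qed.

(** The dependence of the double bracket on the value [r] of [rho], isolated because it is linear:
    the Leibniz rule and [fox_flip] can be substituted for [r]. *)
Definition db_core (x y r : H) : H ⊗ H := \Sw_(r1, r2 of r) ((x * S r1 * y) ⊗ r2).

Lemma dbE a b :
  db a b = \Sw_(a1, a2 of a) \Sw_(b1, b2 of b) db_core b1 a1 (rho a2 b2).
Proof. by []. Qed.

Lemma db_core_mull u x y r :
  db_core (u * x) y r = tlift (fun p q => (u * p) ⊗ q) (db_core x y r).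
Proof.
rewrite /db_core tlift_tlift; last lin.
by apply: eq_tlift => r1 r2; rewrite tliftE ?mulrA //; lin.
Qed.

(** The antipode reverses [r * c2], which brings [c1] next to an antipode and cancels it; the
    surviving component of [c] multiplies the right tensor factor. *)
Lemma db_core_mulr x y r c :
  \Sw_(c1, c2 of c) db_core (x * c1) y (r * c2) =
  tlift (fun p q => p ⊗ (q * c)) (db_core x y r).
Proof.
rewrite /db_core tlift_tlift; last lin.
transitivity (\Sw_(r1, r2 of r) \Sw_(c1, z of c) \Sw_(c2, c3 of z)
    ((x * (c1 * S c2) * S r1 * y) ⊗ (r2 * c3))).
  rewrite tlift_exchange; apply: eq_tlift => c1 c2.
  rewrite tlift_mul; last lin.
  by apply: eq_tlift => r1 r2; apply: eq_tlift => c3 c4; rewrite antipodeM !mulrA.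
apply: eq_tlift => r1 r2; rewrite tliftE; last lin.
rewrite (tlift_cancel _ unitSr (f := fun u v => (x * u * S r1 * y) ⊗ (r2 * v)));
  last lin; last lin.
by rewrite mulr1.
Qed.

Lemma db_mulr a b c : db a (b * c) =
  tlift (fun p q => p ⊗ (q * c)) (db a b) + tlift (fun p q => (b * p) ⊗ q) (db a c).
Proof.
have core_lin x y : linear (db_core x y) by rewrite /db_core; lin.
have core_linl y r : linear (fun x => db_core x y r) by rewrite /db_core; lin.
rewrite !dbE tlift_tlift; last lin.
rewrite tlift_tlift; last lin.
rewrite -tliftD; apply: eq_tlift => a1 a2.
rewrite tlift_tlift; last lin.
rewrite tlift_tlift; last lin.
under [in RHS]eq_tlift => b1 b2 do rewrite -db_core_mulr.
under [X in _ + X]eq_tlift => c1 c2 do rewrite -db_core_mull.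
rewrite tlift_mul; last lin.
have -> : \Sw_(u, v of c) db_core (b * u) a1 (rho a2 v) =
   \Sw_(b1, b2 of b) \Sw_(c1, c2 of c) (eps b2 *: db_core (b1 * c1) a1 (rho a2 c2)).
  under [RHS]eq_tlift => b1 b2 do rewrite tliftZ.
  by rewrite (tlift_counitr (g := fun b => \Sw_(u, v of c) db_core (b * u) a1 (rho a2 v))); last lin.
rewrite -tliftD; apply: eq_tlift => b1 b2.
rewrite -tliftD; apply: eq_tlift => c1 c2.
by rewrite (fox_Mr fox) linear_propD // linear_propZ.
Qed.

Lemma db1r a : db a 1 = 0.
Proof.
have := db_mulr a 1 1; rewrite mulr1.
under eq_tlift => p q do rewrite mulr1.
under [X in _ + X]eq_tlift => p q do rewrite mul1r.
by rewrite tlift_pure => h; apply: (addrI (db a 1)); rewrite addr0 -h.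
Qed.

(** The fourfold coproduct bracketed as it arises when [fox_flip] splits the second component of [a]
    and [db_core_conj] then splits the first half of that. *)
Lemma tlift_cancel4 W (m : H -> H -> H) (G : H -> H -> H -> W) a : bilin m ->
  (forall a, \Sw_(x, y of a) m x y = (eps a)%:A) ->
  (forall y z, linear (fun x => G x y z)) ->
  (forall x z, linear (fun y => G x y z)) ->
  (forall x y, linear (fun z => G x y z)) ->
  \Sw_(a1, a' of a) \Sw_(x, a4 of a') \Sw_(a2, a3 of x) G (m a1 a2) a3 a4 =
  \Sw_(a1, a2 of a) G 1 a1 a2.
Proof.
move=> mb mu G1 G2 G3.
rewrite -(tlift_cancel mb mu (f := fun u z => \Sw_(x, y of z) G u x y)); last lin.
apply: eq_tlift => a1 a'.
by rewrite (tlift_assoc (f := fun a2 a3 a4 => G (m a1 a2) a3 a4)) //; lin.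
Qed.

Lemma db_core_conj u v x y r :
  db_core u v (x * S r * y) =
  \Sw_(x1, x2 of x) \Sw_(y1, y2 of y) \Sw_(r1, r2 of r)
    ((u * S y1 * r1 * (S x1 * v)) ⊗ (x2 * S r2 * y2)).
Proof.
rewrite /db_core tlift_mul; last lin.
rewrite tlift_mul; last lin.
apply: eq_tlift => x1 x2; rewrite comul_antipode tlift_tlift; last lin.
rewrite [RHS]tlift_exchange; apply: eq_tlift => r1 r2; rewrite tliftE; last lin.
by apply: eq_tlift => y1 y2; rewrite !antipodeM antipodeK !mulrA.
Qed.

(* Substituting [fox_flip] for rho(a, b) makes the outer copies of a and b
   cancel, which leaves r' (x) a S(r'') b for r = rho(b, a). *)
Lemma db_antisym a b : db a b = - tlift (fun p q => q ⊗ p) (db b a).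
Proof.
have core_lin x y : linear (db_core x y) by rewrite /db_core; lin.
pose R (x2 a3 : H) (w : H) (y2 b3 : H) := \Sw_(r1, r2 of rho b3 a3) ((w * r1) ⊗ (x2 * S r2 * y2)).
pose Q (w x2 a3 : H) := \Sw_(b1, b' of b) \Sw_(y, b3 of b') \Sw_(y1, y2 of y)
  \Sw_(r1, r2 of rho b3 a3) ((b1 * S y1 * r1 * w) ⊗ (x2 * S r2 * y2)).
transitivity (- \Sw_(a1, a' of a) \Sw_(x, a3 of a') \Sw_(x1, x2 of x)
  Q (S x1 * a1) x2 a3).
  rewrite dbE -tliftN; apply: eq_tlift => a1 a2.
  rewrite -tliftN.
  under [RHS]eq_tlift => x a3 do
    rewrite /Q tlift_exchange -tliftN.
  rewrite [RHS]tlift_exchange; apply: eq_tlift => b1 b2.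
  rewrite fox_flip linear_propN // linear_tlift // -tliftN.
  apply: eq_tlift => x a3; congr (- _).
  rewrite linear_tlift // tlift_exchange; apply: eq_tlift => y b3.
  by rewrite db_core_conj tlift_exchange.
rewrite (tlift_cancel4 _ _ unitSlC); try by rewrite /Q; lin.
rewrite dbE; congr (- _).
rewrite tlift_tlift; last lin.
under [RHS]eq_tlift => b1 b2 do (rewrite tlift_tlift; [|lin]).
rewrite [RHS]tlift_exchange; apply: eq_tlift => a1 a2.
transitivity (\Sw_(b1, b2 of b) R a1 a2 1 b1 b2).
  rewrite -(tlift_cancel4 _ _ unitSr); try by rewrite /R; lin.
  do 3!apply: eq_tlift => ? ?.
  by apply: eq_tlift => r1 r2; rewrite mulr1.
apply: eq_tlift => b1 b2; rewrite /db_core tlift_tlift; last lin.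
rewrite /R tlift_comm; last lin.
by apply: eq_tlift => r1 r2; rewrite tliftE ?mul1r //; lin.
Qed.

(** Antisymmetry is used twice, for the double bracket to exchange its arguments and for [rho] to
    pull the antipodes out of it; the two signs cancel. *)
Lemma db_antipode a b : db (S a) (S b) = tlift (fun p q => S q ⊗ S p) (db a b).
Proof.
have core_lin x y : linear (db_core x y) by rewrite /db_core; lin.
have core_linl y r : linear (fun x => db_core x y r) by rewrite /db_core; lin.
have core_linr x r : linear (fun y => db_core x y r) by rewrite /db_core; lin.
rewrite db_antisym !dbE !comul_antipode (tlift_tlift (V := H)); last lin.
rewrite [RHS]tlift_tlift; last lin.
rewrite tlift_tlift; last lin.
under [RHS]eq_tlift => a1 a2 do (rewrite tlift_tlift; [|lin]).
rewrite -tliftN [RHS]tlift_exchange; apply: eq_tlift => b1 b2.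
rewrite tliftE; last lin.
rewrite tlift_tlift; last lin.
rewrite tlift_tlift; last lin.
rewrite -tliftN; apply: eq_tlift => a1 a2.
rewrite tliftE; last lin.
have -> : rho (S b2) (S a2) = - S (rho a2 b2).
  by rewrite -linearN -anti /fox_transpose antipodeK.
rewrite linear_propN // linear_propN; last by lin.
rewrite opprK /db_core comul_antipode tlift_tlift; last lin.
rewrite tlift_tlift; last lin.
rewrite [RHS]tlift_tlift; last lin.
apply: eq_tlift => r1 r2; rewrite tliftE; last lin.
rewrite tliftE; last lin.
by rewrite tliftE ?antipodeM ?antipodeK ?mulrA //; lin.
Qed.

End FoxPairing.
End HopfAlgebra.


(** * Derivations of presented algebras *)

Section PresentedAlgebra.
Variables (K : fieldType) (X : Type) (Rel : pterm K X -> pterm K X -> Prop).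
Local Notation A := (pres Rel).

Definition derivation (D : A -> A) : Prop :=
  linear D /\ forall x y, D (x * y) = D x * y + x * D y.

Lemma pres_ind (P : A -> Prop) :
  (forall g, P (pgen Rel g)) -> (forall k, P (pconst Rel k)) ->
  (forall x y, P x -> P y -> P (x + y)) ->
  (forall x y, P x -> P y -> P (x * y)) -> forall x, P x.
Proof.
move=> Pg Pk PD PM x; rewrite -(reprK x).
elim: (repr x) => [g|k|p Pp q Pq|p Pp q Pq].
- exact: Pg.
- exact: Pk.
- by rewrite pres_addpE; apply: PD.
- by rewrite pres_mulpE; apply: PM.
Qed.

Lemma pres_mulZl k (x y : A) : (k *: x) * y = k *: (x * y).
Proof. by rewrite pres_scalerAl. Qed.

Lemma pres_mulZr k (x y : A) : x * (k *: y) = k *: (x * y).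
Proof. by rewrite mulrC pres_mulZl mulrC. Qed.

(** Invariance compares maps such as [x |-> br (act g x) (act g y)], which obey the Leibniz rule
    only along the endomorphism [act g]. The condition [phi 1 = 1] makes such maps vanish on
    constants. *)
Lemma derivation_along_eq (phi D D' : A -> A) : phi 1 = 1 ->
  linear D -> (forall x y, D (x * y) = D x * phi y + phi x * D y) ->
  linear D' -> (forall x y, D' (x * y) = D' x * phi y + phi x * D' y) ->
  (forall g, D (pgen Rel g) = D' (pgen Rel g)) -> D =1 D'.
Proof.
move=> phi1 Dl DM Dl' DM' DD'.
have const (E : A -> A) k : linear E ->
    (forall x y, E (x * y) = E x * phi y + phi x * E y) -> E (pconst Rel k) = 0.
  move=> El EM; have -> : pconst Rel k = k *: (1 : A) by rewrite pres_scaleE mulr1.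
  have := EM 1 1; rewrite phi1 !mulr1 mul1r => h.
  rewrite linear_propZ //; suff -> : E 1 = 0 by rewrite scaler0.
  by apply: (addrI (E 1)); rewrite addr0 -h.
elim/pres_ind => [g|k|x y IHx IHy|x y IHx IHy] //.
- by rewrite !const.
- by rewrite !linear_propD // IHx IHy.
- by rewrite DM DM' IHx IHy.
Qed.

Lemma derivation_eq D D' : derivation D -> derivation D' ->
  (forall g, D (pgen Rel g) = D' (pgen Rel g)) -> D =1 D'.
Proof.
by move=> [Dl DM] [Dl' DM']; apply: (derivation_along_eq (phi := fun x => x)).
Qed.

Lemma derivation_zero : derivation (fun=> 0).
Proof.
by split=> [k x y|x y]; rewrite ?scaler0 ?mul0r ?mulr0 addr0.
Qed.

Lemma derivation_add D D' : derivation D -> derivation D' ->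
  derivation (fun x => D x + D' x).
Proof.
move=> [Dl DM] [Dl' DM']; split; first exact: linear_add.
by move=> x y; rewrite DM DM' mulrDl mulrDr addrACA.
Qed.

Lemma derivation_scale k D : derivation D -> derivation (fun x => k *: D x).
Proof.
move=> [Dl DM]; split; first exact: linear_scale.
by move=> x y; rewrite DM scalerDr pres_mulZl pres_mulZr.
Qed.

Lemma derivation_opp D : derivation D -> derivation (fun x => - D x).
Proof.
move=> [Dl DM]; split; first exact: linear_opp.
by move=> x y; rewrite DM opprD mulNr mulrN.
Qed.

Lemma derivation_mulr D c : derivation D -> derivation (fun x => D x * c).
Proof.
move=> [Dl DM]; split=> [k x y|x y].
  by rewrite Dl mulrDl pres_mulZl.
by rewrite DM mulrDl mulrAC mulrA.
Qed.

Lemma derivation_mull D c : derivation D -> derivation (fun x => c * D x).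
Proof.
move=> Dd; have [Dl DM] := derivation_mulr c Dd.
by split=> [k x y|x y]; rewrite ![c * _]mulrC; [apply: Dl|apply: DM].
Qed.

Lemma derivation_sum I (r : seq I) (P : pred I) (D : I -> A -> A) :
  (forall i, derivation (D i)) -> derivation (fun x => \sum_(i <- r | P i) D i x).
Proof.
move=> Dd; elim: r => [|i r IHr].
  by split=> [k x y|x y]; rewrite !big_nil ?scaler0 ?mul0r ?mulr0 addr0.
have : derivation (fun x => (if P i then D i x else 0) +
                            \sum_(i <- r | P i) D i x).
  apply: derivation_add => //; case: (P i) => //; exact: derivation_zero.
rewrite /derivation; move=> [h1 h2]; split=> [k x y|x y].
  by have := h1 k x y; rewrite !big_cons; case: (P i); rewrite ?add0r.
by have := h2 x y; rewrite !big_cons; case: (P i); rewrite ?add0r.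
Qed.

Section Biderivation.
Variable b : X -> X -> A.
Hypothesis b_anti : forall g h, b g h = - b h g.
Hypothesis b_rel : forall g p q,
  Rel p q -> pterm_der (b g) p = pterm_der (b g) q.

Definition pres_bider (x y : A) : A := pres_der (fun g => pres_der (b g) y) x.

Lemma pres_der_derivation g : derivation (pres_der (b g)).
Proof. by have [] := pres_derP (@b_rel g). Qed.

(* Extending first in the right variable makes the compatibility with [Rel] in
   the left variable an equality of derivations, hence checkable on generators,
   where it follows from antisymmetry. *)
Lemma pterm_der_derivation p :
  derivation (fun y => pterm_der (fun g => pres_der (b g) y) p).
Proof.
elim: p => [g|k|p Dp q Dq|p Dp q Dq] /=.
- exact: pres_der_derivation.
- exact: derivation_zero.
- exact: derivation_add.
- by apply: derivation_add; [apply: derivation_mulr | apply: derivation_mull].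
Qed.

Lemma pterm_der_opp (f f' : X -> A) p : (forall g, f g = - f' g) ->
  pterm_der f p = - pterm_der f' p.
Proof.
move=> ff'; elim: p => [g|k|p IHp q IHq|p IHp q IHq] //=.
- by rewrite oppr0.
- by rewrite IHp IHq opprD.
- by rewrite IHp IHq opprD mulNr mulrN.
Qed.

Lemma pres_bider_rel y p q : Rel p q ->
  pterm_der (fun g => pres_der (b g) y) p =
  pterm_der (fun g => pres_der (b g) y) q.
Proof.
move=> pq; move: y; apply: derivation_eq; try exact: pterm_der_derivation.
move=> h.
have genr g : pres_der (b g) (pgen Rel h) = - b h g.
  by rewrite b_anti opprK; have [_ _ ->] := pres_derP (@b_rel g).
by rewrite (pterm_der_opp p genr) (pterm_der_opp q genr) (b_rel h pq).
Qed.

Lemma pres_bider_derl y : derivation (pres_bider^~ y).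
Proof. by have [] := pres_derP (@pres_bider_rel y). Qed.

Lemma pres_bider_genl g y : pres_bider (pgen Rel g) y = pres_der (b g) y.
Proof. by rewrite /pres_bider; have [_ _ ->] := pres_derP (@pres_bider_rel y). Qed.

Lemma pres_bider_gen g h : pres_bider (pgen Rel g) (pgen Rel h) = b g h.
Proof.
by rewrite pres_bider_genl; have [_ _ ->] := pres_derP (@b_rel g).
Qed.

Lemma pres_bider_derr x : derivation (pres_bider x).
Proof. exact: pterm_der_derivation. Qed.

Lemma pres_bider_anti x y : pres_bider x y = - pres_bider y x.
Proof.
move: x; apply: derivation_eq; first exact: pres_bider_derl.
  exact/derivation_opp/pres_bider_derr.
move=> g; move: y; apply: derivation_eq; first exact: pres_bider_derr.
  exact/derivation_opp/pres_bider_derl.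
by move=> h; rewrite !pres_bider_gen.
Qed.

End Biderivation.

Lemma biderivation_ext (br br' : A -> A -> A) :
  (forall y, derivation (br^~ y)) -> (forall x, derivation (br x)) ->
  (forall y, derivation (br'^~ y)) -> (forall x, derivation (br' x)) ->
  (forall g h, br (pgen Rel g) (pgen Rel h) = br' (pgen Rel g) (pgen Rel h)) ->
  br = br'.
Proof.
move=> l r l' r' e; apply/funext => x; apply/funext => y.
by move: x; apply: derivation_eq => // g; move: y; apply: derivation_eq.
Qed.

Lemma triderivation_eq (T T' : A -> A -> A -> A) :
  (forall y z, derivation (fun x => T x y z)) ->
  (forall x z, derivation (fun y => T x y z)) ->
  (forall x y, derivation (fun z => T x y z)) ->
  (forall y z, derivation (fun x => T' x y z)) ->
  (forall x z, derivation (fun y => T' x y z)) ->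
  (forall x y, derivation (fun z => T' x y z)) ->
  (forall f g h, T (pgen Rel f) (pgen Rel g) (pgen Rel h) =
                 T' (pgen Rel f) (pgen Rel g) (pgen Rel h)) ->
  forall x y z, T x y z = T' x y z.
Proof.
move=> T1 T2 T3 T1' T2' T3' e x y z.
move: x; apply: derivation_eq => // f; move: y; apply: derivation_eq => // g.
by move: z; apply: derivation_eq.
Qed.

(** Expanding the double brackets of a product also yields products of two single brackets; these
    cancel in pairs by antisymmetry. *)
Lemma jacobi_derivation (br : A -> A -> A) y z :
  (forall y, derivation (br^~ y)) -> (forall x, derivation (br x)) ->
  (forall x y, br x y = - br y x) ->
  derivation (fun x => br x (br y z) + br y (br z x) + br z (br x y)).
Proof.
move=> brl brr anti; split=> [k x x'|x x'].
  rewrite (brl _).1 (brr z).1 (brr y).1 (brl y).1 (brr z).1 !scalerDr; ring.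
rewrite (brl _).2 (brr z).2 (linear_propD (brr y).1) !(brr y).2.
rewrite (brl y).2 (linear_propD (brr z).1) !(brr z).2.
rewrite (anti x y) (anti x' y); ring.
Qed.

End PresentedAlgebra.


Lemma det_mx3 (R : comPzRingType) (M : 'M[R]_3) : \det M =
  M 0 0 * M 1 1 * M 2 2 - M 0 0 * M 1 2 * M 2 1 - M 0 1 * M 1 0 * M 2 2
  + M 0 1 * M 1 2 * M 2 0 + M 0 2 * M 1 0 * M 2 1 - M 0 2 * M 1 1 * M 2 0.
Proof.
(* Entries are indexed by natural numbers, so that the different lifts of ordinals produced by the
   cofactor expansion become syntactically equal. *)
pose m p q := M (inord p) (inord q).
have mE i j : M i j = m i j by rewrite /m !inord_val.
rewrite (expand_det_row _ ord0) !big_ord_recl big_ord0 /cofactor.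
rewrite !(expand_det_row _ ord0) !big_ord_recl !big_ord0 /cofactor !det_mx11 !mxE.
by rewrite !mE /= /bump /=; ring.
Qed.

(** * The bracket on twisted representation algebras *)

Section TwistedBracket.
Variables (K : fieldType) (H : algType K).
Variables (Delta : {linear H -> tensor H H}) (eps : {scalar H}).
Variables (S : {linear H -> H}) (rho : H -> H -> H).
Hypothesis hopf : cocommutative_hopf Delta eps S.
Hypothesis fox : fox_pairing eps rho.
Hypothesis anti : fox_antisymmetric S rho.
Variables (N : nat) (sgn : 'I_N -> K) (tau : 'I_N -> 'I_N) (J : 'M[K]_N).
Hypothesis J_twist : twist_form sgn tau J.

Local Notation db := (dbracket Delta S rho).
Local Notation A := (twrep S sgn tau).
Local Notation X := (H * 'I_N * 'I_N)%type.
Local Notation ent := (@entry K H S N sgn tau).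
Local Notation tent := (@tentry K H S N sgn tau).
Implicit Types (a b c : H) (i j k l m n : 'I_N) (f g h : X).

Let tauK : involutive tau. Proof. by case: J_twist. Qed.
Let sgnK i : sgn i * sgn i = 1. Proof. by case: J_twist. Qed.
Let sgn_tau2 i j : sgn (tau i) * sgn (tau j) = sgn i * sgn j.
Proof. by case: J_twist => _ _ [e [eK se]] _; rewrite !se mulrACA eK mul1r. Qed.
Let rho_bilin : bilin rho := fox_bilin fox.
Let dbb : bilin db := db_bilin Delta S fox.

Lemma entry_linear i j : linear (fun a => ent a i j).
Proof.
move=> k a b; have /matrixP/(_ i j) := gen_mxD S sgn tau (k *: a) b.
have /matrixP/(_ i j) := gen_mxZ S sgn tau k a.
by rewrite !mxE => ->.
Qed.

Let entl := entry_linear.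

Lemma entryM a b i j : ent (a * b) i j = \sum_r ent a i r * ent b r j.
Proof.
have /matrixP/(_ i j) := gen_mxM S sgn tau a b; rewrite !mxE => ->.
by apply: eq_bigr => r _; rewrite !mxE.
Qed.

Lemma entry1 i j : ent 1 i j = (i == j)%:R.
Proof. by have /matrixP/(_ i j) := gen_mx1 S sgn tau; rewrite !mxE. Qed.

Lemma entryS a i j : ent (S a) i j = (sgn i * sgn j) *: ent a (tau j) (tau i).
Proof. by rewrite [LHS](pi_rel (twrep_twist S sgn tau a i j)) pres_mulpE. Qed.

(* The twisting involution, on generators; the scalar is put on the algebra
   element so that the image is again a generator. *)
Definition flip g : X := ((sgn g.1.2 * sgn g.2) *: S g.1.1, tau g.2, tau g.1.2).

Lemma flipK : involutive flip.
Proof.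
case=> [[a i] j]; rewrite /flip /= linearZ /= (antipodeK hopf) !tauK scalerA.
by rewrite sgn_tau2 (mulrC (sgn j)) mulrACA !sgnK mulr1 scale1r.
Qed.

Lemma tentry_linear i j k l : linear (fun t => tent t i j k l).
Proof. by rewrite /tentry; lin. Qed.

(* The bracket {a_ij, b_kl} = {{a, b}}_(kj, il) of the untwisted
   representation algebra, read in the twisted one. *)
Definition gl_bracket f g : A := tent (db f.1.1 g.1.1) g.1.2 f.2 f.1.2 g.2.
Local Notation P2 := gl_bracket.

Lemma gl_bracket_linearl i j g : linear (fun a => P2 (a, i, j) g).
Proof. by rewrite /gl_bracket /tentry /=; lin. Qed.

Lemma gl_bracket_linearr f i j : linear (fun a => P2 f (a, i, j)).
Proof. by rewrite /gl_bracket /tentry /=; lin. Qed.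

Lemma gl_bracket_anti f g : P2 f g = - P2 g f.
Proof.
rewrite /gl_bracket /tentry (db_antisym hopf fox anti).
rewrite (linear_propN (f := tlift _)); last lin.
rewrite tlift_tlift; last lin.
by congr (- _); apply: eq_tlift => p q; rewrite tliftE ?[_ * ent q _ _]mulrC //; lin.
Qed.

Lemma gl_bracket_flip f g : P2 (flip f) (flip g) = P2 f g.
Proof.
case: f => [[a i] j]; case: g => [[b k] l]; rewrite /gl_bracket /flip /=.
rewrite (linear_propZ (dbb.1 _)) (linear_propZ (dbb.2 _)) scalerA.
rewrite (db_antipode hopf fox anti) /tentry.
rewrite (linear_propZ (f := tlift _)); last lin.
rewrite tlift_tlift; last lin.
rewrite -tliftZ; apply: eq_tlift => p q; rewrite tliftE; last lin.
rewrite !entryS !tauK -pres_scalerAl pres_mulZr !scalerA.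
rewrite !sgn_tau2 mulrC; set c := _ * _.
suff -> : c = 1 by rewrite scale1r mulrC.
transitivity ((sgn i * sgn i) * (sgn j * sgn j) * (sgn k * sgn k) *
  (sgn l * sgn l)); first by rewrite /c; ring.
by rewrite !sgnK !mulr1.
Qed.

(** As twisting both arguments changes nothing, a twist of the second argument can be carried over
    to the first. *)
Lemma gl_bracketS f a i j :
  P2 f (S a, i, j) = (sgn i * sgn j) *: P2 (flip f) (a, tau j, tau i).
Proof.
rewrite -(gl_bracket_flip (flip f)) flipK /flip /= !tauK.
rewrite (linear_propZ (gl_bracket_linearr _ _ _)) scalerA.
by rewrite sgn_tau2 (mulrC (sgn j)) mulrACA !sgnK mulr1 scale1r.
Qed.

(** [db_mulr] multiplies the first factor by [b] on the left and the second by [c] on the right, and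
    these factors sit at [k j] and [i l]: the new summation index appears next to [k], respectively
    next to [l]. *)
Lemma gl_bracketM f b c k l :
  P2 f (b * c, k, l) =
  \sum_r (P2 f (b, k, r) * ent c r l + ent b k r * P2 f (c, r, l)).
Proof.
case: f => [[a i] j]; rewrite /gl_bracket /= (db_mulr hopf fox).
rewrite (linear_propD (tentry_linear _ _ _ _)) big_split /= /tentry.
have mull (x : A) (F : H -> H -> A) t : tlift F t * x = tlift (fun u v => F u v * x) t.
  exact: (linear_tlift (linear_pres_mull x (linear_id (U := A)))).
have mulr (x : A) (F : H -> H -> A) t : x * tlift F t = tlift (fun u v => x * F u v) t.
  exact: (linear_tlift (linear_pres_mulr x (linear_id (U := A)))).
congr (_ + _).
  under [RHS]eq_bigr => r _ do rewrite mull //.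
  rewrite tlift_tlift; last lin.
  rewrite -tlift_sum; apply: eq_tlift => p q; rewrite tliftE; last lin.
  by rewrite entryM mulr_sumr; apply: eq_bigr => r _; rewrite mulrA.
under [RHS]eq_bigr => r _ do rewrite mulr //.
rewrite tlift_tlift; last lin.
rewrite -tlift_sum; apply: eq_tlift => p q; rewrite tliftE; last lin.
by rewrite entryM mulr_suml; apply: eq_bigr => r _; rewrite mulrA.
Qed.

Lemma gl_bracket1 f k l : P2 f (1, k, l) = 0.
Proof.
by rewrite /gl_bracket (db1r hopf fox) (linear_prop0 (tentry_linear _ _ _ _)).
Qed.

Hypothesis two_neq0 : (2 : K) != 0.

Definition tw_bracket f g : A := 2^-1 *: (P2 f g + P2 (flip f) g).

Lemma tw_bracket_anti f g : tw_bracket f g = - tw_bracket g f.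
Proof.
rewrite /tw_bracket -scalerN opprD -!gl_bracket_anti.
by rewrite -(gl_bracket_flip f (flip g)) flipK.
Qed.

Lemma tw_bracket_rel f p q : twrep_rel S sgn tau p q ->
  pterm_der (tw_bracket f) p = pterm_der (tw_bracket f) q.
Proof.
have D2 (x y u v : A) : 2^-1 *: (x + y + (u + v)) = 2^-1 *: (x + u) + 2^-1 *: (y + v).
  by rewrite addrACA scalerDr.
case=> {p q} [p q [a b i j|k a i j|a b i j|i j]|a i j] /=; rewrite /tw_bracket.
- by rewrite !(linear_propD (gl_bracket_linearr _ _ _)) D2.
- rewrite !(linear_propZ (gl_bracket_linearr _ _ _)) -scalerDr mul0r add0r.
  by rewrite scalerA mulrC -scalerA.
- rewrite pterm_der_sum /= /tw_bracket !gl_bracketM -big_split scaler_sumr.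
  apply: eq_bigr => r _; rewrite D2 pres_mulZr -pres_scalerAl.
  by rewrite mulrDl mulrDr.
- by rewrite !gl_bracket1 addr0 scaler0.
(* The twist relation holds because [gl_bracketS] exchanges the two summands of the average. *)
- rewrite mul0r add0r.
  rewrite !gl_bracketS -scalerDr scalerA mulrC -scalerA.
  rewrite -[RHS]pres_scaleE; congr (_ *: (_ *: _)).
  by rewrite flipK addrC.
Qed.

Definition tw_bider : A -> A -> A := pres_bider tw_bracket.

Lemma tw_bider_derl y : derivation (tw_bider^~ y).
Proof. exact: pres_bider_derl tw_bracket_anti tw_bracket_rel y. Qed.

Lemma tw_bider_derr x : derivation (tw_bider x).
Proof. exact: pres_bider_derr tw_bracket_rel x. Qed.

Lemma tw_bider_anti : antisymmetric_bracket tw_bider.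
Proof. exact: pres_bider_anti tw_bracket_anti tw_bracket_rel. Qed.

Lemma tw_bider_gen f g :
  tw_bider (pgen _ f) (pgen _ g) = 2^-1 *: (P2 f g + P2 (flip f) g).
Proof. exact: pres_bider_gen tw_bracket_anti tw_bracket_rel f g. Qed.

Lemma tw_bider_biderivation : biderivation tw_bider.
Proof.
split=> [y|x|x y z|x y z].
- exact: (tw_bider_derl y).1.
- exact: (tw_bider_derr x).1.
- by rewrite (tw_bider_derl z).2 addrC.
- exact: (tw_bider_derr x).2.
Qed.

(** * Iterated brackets, the tritensor map and the Jacobiator *)

(* The Leibniz extension of {f, -} to c_ml d_kn, for t = sum of c (x) d. *)
Definition gl_der f (t : H ⊗ H) m l k n : A :=
  tlift (fun p q => P2 f (p, m, l) * ent q k n + ent p m l * P2 f (q, k, n)) t.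

Lemma tw_bider_tentry f t m l k n :
  tw_bider (pgen _ f) (tent t m l k n) =
  2^-1 *: (gl_der f t m l k n + gl_der (flip f) t m l k n).
Proof.
have [Dl DM] := tw_bider_derr (pgen _ f).
rewrite /tentry linear_tlift // /gl_der -tliftD -tliftZ.
apply: eq_tlift => p q; rewrite DM !tw_bider_gen -pres_scalerAl pres_mulZr.
by rewrite -scalerDr mulrDl mulrDr addrACA.
Qed.

(* {f, {g, h}} in the untwisted representation algebra. *)
Definition gl_double f g h : A :=
  gl_der f (db g.1.1 h.1.1) h.1.2 g.2 g.1.2 h.2.
Local Notation P3 := gl_double.

Lemma tw_bider_double f g h :
  tw_bider (pgen _ f) (tw_bider (pgen _ g) (pgen _ h)) =
  4^-1 *: (P3 f g h + P3 (flip f) g h + P3 f (flip g) h + P3 (flip f) (flip g) h).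
Proof.
have [Dl _] := tw_bider_derr (pgen _ f).
rewrite tw_bider_gen linear_propZ // linear_propD // !tw_bider_tentry.
by rewrite -scalerDr scalerA -invfM -natrM addrA.
Qed.


Lemma gl_double_flip f g h : P3 (flip f) (flip g) (flip h) = P3 f g h.
Proof.
case: g => [[b k] l]; case: h => [[c m] n]; rewrite /gl_double.
rewrite {2 4}/flip /= /gl_der.
rewrite (linear_propZ (dbb.1 _)) (linear_propZ (dbb.2 _)) scalerA.
rewrite (db_antipode hopf fox anti).
have lind e i j : linear (fun a => P2 e (a, i, j)) by apply: gl_bracket_linearr.
rewrite (linear_propZ (f := tlift _)); last lin.
rewrite tlift_tlift; last lin.
rewrite -tliftZ; apply: eq_tlift => p q; rewrite tliftE; last lin.
rewrite !gl_bracketS !entryS !tauK flipK !sgn_tau2 pres_mulZr -!pres_scalerAl.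
rewrite !pres_mulZr !scalerA.
have -> : sgn n * sgn k * (sgn l * sgn m) = sgn k * sgn l * (sgn m * sgn n) by ring.
have -> : sgn l * sgn m * (sgn n * sgn k) = sgn k * sgn l * (sgn m * sgn n) by ring.
rewrite -scalerDr scalerA; set c2 := (X in X *: _); have -> : c2 = 1.
  transitivity ((sgn k * sgn k) * (sgn l * sgn l) * (sgn m * sgn m) *
    (sgn n * sgn n)); first by rewrite /c2; ring.
  by rewrite !sgnK !mulr1.
by rewrite scale1r addrC mulrC [P2 f (q, k, n) * _]mulrC.
Qed.

Definition tentry3 (t : H ⊗ (H ⊗ H)) i1 j1 i2 j2 i3 j3 : A :=
  tlift3 (fun x y z => ent x i1 j1 * ent y i2 j2 * ent z i3 j3) t.

Lemma tentry3_linear i1 j1 i2 j2 i3 j3 :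
  linear (fun t => tentry3 t i1 j1 i2 j2 i3 j3).
Proof. by rewrite /tentry3 /tlift3; lin. Qed.

Lemma tentry3E x y z i1 j1 i2 j2 i3 j3 :
  tentry3 (x ⊗ (y ⊗ z)) i1 j1 i2 j2 i3 j3 = ent x i1 j1 * ent y i2 j2 * ent z i3 j3.
Proof. by rewrite /tentry3 /tlift3 tliftE ?tliftE //; lin. Qed.

(** [triF] is an iterated double bracket: the second leg of [db a b] is bracketed with [c].
    Coassociativity identifies the threefold coproduct of the inner [rho] with the two successive
    ones. *)
Lemma tentry3_triF a b c i1 j1 i2 j2 i3 j3 :
  tentry3 (triF Delta S rho a b c) i1 j1 i2 j2 i3 j3 =
  tlift (fun p q => ent p i1 j1 * tent (db q c) i2 j2 i3 j3) (db a b).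
Proof.
have lin3 := tentry3_linear i1 j1 i2 j2 i3 j3.
rewrite /triF {2}/dbracket tlift_tlift; last by rewrite /tentry; lin.
rewrite (linear_tlift lin3); apply: eq_tlift => a1 a2.
rewrite tlift_tlift; last by rewrite /tentry; lin.
rewrite (linear_tlift lin3); apply: eq_tlift => b1 b2.
rewrite tlift_tlift; last by rewrite /tentry; lin.
rewrite (linear_tlift lin3).
under eq_tlift => c1 c2.
  rewrite (tlift3_comul2 hopf); try by lin.
  rewrite (linear_tlift lin3).
  over.
rewrite tlift_exchange; apply: eq_tlift => r1 r2.
rewrite tliftE; last by rewrite /tentry; lin.
have Ll : linear (fun t => ent (b1 * S r1 * a1) i1 j1 * tent t i2 j2 i3 j3).
  by rewrite /tentry; lin.
rewrite dbE; apply: etrans (esym (linear_tlift Ll _ _)).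
under eq_tlift => c1 c2 do rewrite (linear_tlift lin3).
rewrite tlift_exchange; apply: eq_tlift => s2 s3.
apply: etrans (esym (linear_tlift Ll _ _)); apply: eq_tlift => c1 c2.
rewrite (linear_tlift lin3).
apply: etrans (esym (linear_tlift Ll _ _)); apply: eq_tlift => u1 u2.
by rewrite tentry3E /tentry tliftE ?mulrA //; lin.
Qed.

(** [tentry3_triF] reaches only the second leg of a double bracket. The first leg of [db b c] is
    reached by writing it as minus the flip of [db c b], which gives the first term its opposite
    sign. *)
Lemma gl_double_triF a b c i j k l m n :
  P3 (a, i, j) (b, k, l) (c, m, n) =
  tentry3 (triF Delta S rho c b a) k n i l m j -
  tentry3 (triF Delta S rho b c a) m l i n k j.
Proof.
rewrite !tentry3_triF /gl_double /gl_der /= tliftD.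
congr (_ + _); last first.
  rewrite -tliftN; apply: eq_tlift => p q.
  by rewrite (gl_bracket_anti (a, i, j)) mulrN.
rewrite (db_antisym hopf fox anti).
rewrite (linear_propN (f := tlift _)); last first.
  by rewrite /gl_bracket /tentry /=; lin.
rewrite tlift_tlift; last by rewrite /gl_bracket /tentry /=; lin.
rewrite -tliftN; apply: eq_tlift => q p.
rewrite tliftE; last by rewrite /gl_bracket /tentry /=; lin.
by rewrite (gl_bracket_anti (a, i, j)) mulNr opprK mulrC.
Qed.

Lemma tentry3_tau123V t i1 j1 i2 j2 i3 j3 :
  tentry3 (tau123V t) i1 j1 i2 j2 i3 j3 = tentry3 t i3 j3 i1 j1 i2 j2.
Proof.
have lin3 := tentry3_linear i1 j1 i2 j2 i3 j3.
rewrite /tau123V {1}/tlift3 (linear_tlift lin3) {2}/tentry3 /tlift3.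
apply: eq_tlift => x u; rewrite (linear_tlift lin3).
by apply: eq_tlift => y z; rewrite tentry3E mulrC mulrA.
Qed.

Definition gl_jacobiator f g h : A := P3 f g h + P3 g h f + P3 h f g.
Local Notation J0 := gl_jacobiator.

Lemma gl_jacobiator_tritensor a b c i j k l m n :
  J0 (a, i, j) (b, k, l) (c, m, n) =
  tentry3 (tritensor Delta S rho c b a) k n i l m j -
  tentry3 (tritensor Delta S rho a b c) k j m l i n.
Proof.
rewrite /gl_jacobiator /tritensor !(linear_propD (tentry3_linear _ _ _ _ _ _)).
rewrite !tentry3_tau123V !gl_double_triF; ring.
Qed.

Lemma gl_jacobiator_flip f g h : J0 (flip f) (flip g) (flip h) = J0 f g h.
Proof. by rewrite /gl_jacobiator !gl_double_flip. Qed.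

Lemma tw_jacobiator_gen f g h :
  jacobiator tw_bider (pgen _ f) (pgen _ g) (pgen _ h) =
  4^-1 *: (J0 f g h + J0 (flip f) g h + J0 f (flip g) h + J0 (flip f) (flip g) h).
Proof.
rewrite /jacobiator !tw_bider_double -!scalerDr; congr (_ *: _).
(* Each cyclic term averages over the twists of its own first two arguments. Twisting all three is
   free, so a twist of the last argument is traded for twists of the other two. *)
have e x y z : P3 x y (flip z) = P3 (flip x) (flip y) z.
  by rewrite -(gl_double_flip x y) flipK.
by rewrite /gl_jacobiator !e !flipK; ring.
Qed.

Lemma tw_jacobiator_derivation y z :
  derivation (fun x => jacobiator tw_bider x y z).
Proof.
exact: jacobi_derivation tw_bider_derl tw_bider_derr tw_bider_anti.
Qed.

Lemma jacobiatorC (br : A -> A -> A) x y z : jacobiator br x y z = jacobiator br y z x.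
Proof. by rewrite /jacobiator -addrA addrC. Qed.

Lemma tw_jacobiator_eq (T : A -> A -> A -> A) :
  (forall y z, derivation (fun x => T x y z)) ->
  (forall x z, derivation (fun y => T x y z)) ->
  (forall x y, derivation (fun z => T x y z)) ->
  (forall f g h, jacobiator tw_bider (pgen _ f) (pgen _ g) (pgen _ h) =
                 T (pgen _ f) (pgen _ g) (pgen _ h)) ->
  forall x y z, jacobiator tw_bider x y z = T x y z.
Proof.
apply: triderivation_eq => [y z|x z|x y]; first exact: tw_jacobiator_derivation.
- have -> : (fun y => jacobiator tw_bider x y z) = fun y => jacobiator tw_bider y z x.
    by apply/funext => y; rewrite jacobiatorC.
  exact: tw_jacobiator_derivation.
- have -> : jacobiator tw_bider x y = fun z => jacobiator tw_bider z x y.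
    by apply/funext => z; rewrite [RHS]jacobiatorC.
  exact: tw_jacobiator_derivation.
Qed.

Lemma tw_poisson : (forall x y z, tritensor Delta S rho x y z = 0) ->
  poisson_bracket tw_bider.
Proof.
move=> tri0; split; [exact: tw_bider_biderivation | exact: tw_bider_anti |].
apply: tw_jacobiator_eq => [y z|x z|x y|f g h]; try exact: derivation_zero.
have J00 f' g' h' : gl_jacobiator f' g' h' = 0.
  case: f' => [[a i] j]; case: g' => [[b k] l]; case: h' => [[c m] n].
  rewrite gl_jacobiator_tritensor !tri0.
  by rewrite !(linear_prop0 (tentry3_linear _ _ _ _ _ _)) subrr.
by rewrite tw_jacobiator_gen !J00 !addr0 scaler0.
Qed.

(** The inverse is the adjoint [J^-1 g^T J]; since [J] has one nonzero entry per row, each of its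
    entries is a signed entry of [g]. *)
Lemma isometry_inv (g : 'M[K]_N) i p : isometry_group J g ->
  invmx g i p = sgn i * sgn p * g (tau p) (tau i).
Proof.
case=> gU gJ; move: i p; pose W := \matrix_(i, p) (sgn i * sgn p * g (tau p) (tau i)).
suff Wg : W *m g = 1%:M.
  by move=> i p; rewrite -[invmx g]mul1mx -Wg -mulmxA mulmxV // mulmx1 mxE.
apply/matrixP=> i j; rewrite !mxE.
have h : \sum_q sgn (tau q) * g (tau q) (tau i) * g q j = sgn (tau i) *+ (i == j).
  have [_ _ _ JE] := J_twist.
  have <- : (g^T *m J *m g) (tau i) j = sgn (tau i) *+ (i == j).
    by rewrite gJ JE mxE tauK eq_sym.
  rewrite mxE; apply: eq_bigr => q _; congr (_ * _).
  rewrite mxE (bigD1 (tau q)) //= big1 ?addr0 => [|r rq].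
    by rewrite JE !mxE tauK eqxx mulr1n mulrC.
  rewrite JE !mxE; case: eqP => [qr|_]; last by rewrite mulr0n mulr0.
  by rewrite qr tauK eqxx in rq.
transitivity (sgn (tau i) * (sgn (tau i) *+ (i == j))); last first.
  by rewrite mulrnAr sgnK.
rewrite -h mulr_sumr; apply: eq_bigr => q _; rewrite mxE -(sgn_tau2 i) !mulrA.
by [].
Qed.


(** * Invariance under the isometry group *)

Section Invariance.
Variable g : 'M[K]_N.
Hypothesis g_iso : isometry_group J g.
Local Notation act := (@act K H S N sgn tau g).
Local Notation V := (invmx g).

Let act_lin : linear act. Proof. by have [] := act_well_defined S J_twist g_iso. Qed.
Let actM x y : act (x * y) = act x * act y.
Proof. by have [_ -> _ _] := act_well_defined S J_twist g_iso. Qed.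
Let act1 : act 1 = 1.
Proof. by have [_ _ -> _] := act_well_defined S J_twist g_iso. Qed.

Lemma act_entry a i j :
  act (ent a i j) = \sum_p \sum_q (V i p * g q j) *: ent a p q.
Proof.
have [_ _ _ /(_ a) /matrixP/(_ i j)] := act_well_defined S J_twist g_iso.
rewrite !mxE => ->; rewrite exchange_big; apply: eq_bigr => q _.
rewrite !mxE mulr_suml; apply: eq_bigr => p _.
by rewrite !mxE mulrAC -rmorphM.
Qed.

Lemma act_gl_bracket a i j b k l : act (P2 (a, i, j) (b, k, l)) =
  \sum_p \sum_q \sum_r \sum_s (V i p * g q j * (V k r * g s l)) *:
    P2 (a, p, q) (b, r, s).
Proof.
rewrite /gl_bracket /tentry /= (linear_tlift act_lin).
under [RHS]eq_bigr => p _ do under eq_bigr => q _ do under eq_bigr => r _ do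
  under eq_bigr => s _ do rewrite -tliftZ.
under [RHS]eq_bigr => p _ do under eq_bigr => q _ do under eq_bigr => r _ do
  rewrite -tlift_sum.
under [RHS]eq_bigr => p _ do under eq_bigr => q _ do rewrite -tlift_sum.
under [RHS]eq_bigr => p _ do rewrite -tlift_sum.
rewrite -tlift_sum; apply: eq_tlift => c d; rewrite actM !act_entry.
under [RHS]eq_bigr => p _ do rewrite exchange_big.
rewrite [RHS]exchange_big /= mulr_suml; apply: eq_bigr => r _.
rewrite mulr_sumr; apply: eq_bigr => p _.
rewrite mulr_suml; apply: eq_bigr => q _; rewrite mulr_sumr; apply: eq_bigr => s _.
rewrite pres_mulZr -pres_scalerAl scalerA; congr (_ *: _).
by ring.
Qed.

(** The twist transposes, hence exchanges the roles of [g] and its inverse under conjugation;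
    [isometry_inv] restores them. *)
Lemma flip_reindex (F : 'I_N -> 'I_N -> A) i j :
  \sum_p \sum_q (V (tau j) p * g q (tau i)) *: F p q =
  (sgn i * sgn j) *: \sum_p \sum_q (V i p * g q j * (sgn p * sgn q)) *:
    F (tau q) (tau p).
Proof.
rewrite (reindex_inj (inv_inj tauK)) /= exchange_big (reindex_inj (inv_inj tauK)) /=.
rewrite scaler_sumr; apply: eq_bigr => p _; rewrite scaler_sumr.
apply: eq_bigr => q _; rewrite scalerA; congr (_ *: _).
rewrite !(isometry_inv _ _ g_iso) !tauK sgn_tau2.
transitivity ((sgn p * sgn p) * (sgn i * sgn i) * (sgn j * sgn q * g q j * g (tau p) (tau i))).
  by rewrite !sgnK; ring.
by ring.
Qed.

Lemma act_flip_bracket f h : act (P2 (flip f) h) =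
  \sum_p \sum_q \sum_r \sum_s
    (V f.1.2 p * g q f.2 * (V h.1.2 r * g s h.2)) *:
    P2 (flip (f.1.1, p, q)) (h.1.1, r, s).
Proof.
case: f => [[a i] j]; case: h => [[b k] l]; rewrite {1}/flip /=.
rewrite (linear_propZ (gl_bracket_linearl _ _ _)) (linear_propZ act_lin).
rewrite act_gl_bracket.
pose F p q := \sum_r \sum_s (V k r * g s l) *: P2 (S a, p, q) (b, r, s).
transitivity ((sgn i * sgn j) *: \sum_p \sum_q (V (tau j) p * g q (tau i)) *: F p q).
  congr (_ *: _); apply: eq_bigr => p _; apply: eq_bigr => q _.
  rewrite scaler_sumr; apply: eq_bigr => r _; rewrite scaler_sumr.
  by apply: eq_bigr => s _; rewrite scalerA.
rewrite flip_reindex scalerA mulrACA !sgnK mulr1 scale1r.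
apply: eq_bigr => p _; apply: eq_bigr => q _; rewrite /F scaler_sumr.
apply: eq_bigr => r _; rewrite scaler_sumr; apply: eq_bigr => s _.
rewrite /flip /= (linear_propZ (gl_bracket_linearl _ _ _)) !scalerA; congr (_ *: _).
by ring.
Qed.

(** In each variable both sides are derivations along [act], so they are compared on generators,
    where both expand over conjugated indices. *)
Lemma tw_bider_act x y : tw_bider (act x) (act y) = act (tw_bider x y).
Proof.
have := @derivation_along_eq _ _ _ act.
move=> along; move: x; apply: along => //.
- by move=> k x x'; rewrite act_lin (tw_bider_derl _).1.
- by move=> x x'; rewrite actM (tw_bider_derl _).2.
- by move=> k x x'; rewrite (tw_bider_derl _).1 act_lin.
- by move=> x x'; rewrite (tw_bider_derl _).2 (linear_propD act_lin) !actM.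
move=> f; have := @derivation_along_eq _ _ _ act.
move=> along; move: y; apply: along => //.
- by move=> k x x'; rewrite act_lin (tw_bider_derr _).1.
- by move=> x x'; rewrite actM (tw_bider_derr _).2.
- by move=> k x x'; rewrite (tw_bider_derr _).1 act_lin.
- by move=> x x'; rewrite (tw_bider_derr _).2 (linear_propD act_lin) !actM.
move=> h; rewrite tw_bider_gen (linear_propZ act_lin) (linear_propD act_lin).
rewrite act_flip_bracket; case: f => [[a i] j]; case: h => [[b k] l].
rewrite act_gl_bracket /=.
have -> : act (pgen _ (a, i, j)) = _ := act_entry a i j.
have -> : act (pgen _ (b, k, l)) = _ := act_entry b k l.
rewrite -big_split scaler_sumr (linear_prop_sum (tw_bider_derl _).1) /=.
apply: eq_bigr => p _; rewrite -big_split scaler_sumr.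
rewrite (linear_prop_sum (tw_bider_derl _).1) /=; apply: eq_bigr => q _.
rewrite -big_split scaler_sumr (linear_propZ (tw_bider_derl _).1).
rewrite (linear_prop_sum (tw_bider_derr _).1) scaler_sumr /=.
apply: eq_bigr => r _; rewrite -big_split scaler_sumr.
rewrite (linear_prop_sum (tw_bider_derr _).1) scaler_sumr /=.
apply: eq_bigr => s _; rewrite (linear_propZ (tw_bider_derr _).1).
by rewrite tw_bider_gen -scalerDr !scalerA mulrC.
Qed.

End Invariance.

(** * The Cartan trivector of gl_N on generators *)

(** The commutator action is needed for all of gl_N, whereas [inf_act] is shown to be a derivation
    for isometries only; hence a separate formula on generators. *)
Definition gl_act (xi : 'M[K]_N) f : A :=
  \sum_p xi p f.2 *: ent f.1.1 f.1.2 p - \sum_p xi f.1.2 p *: ent f.1.1 p f.2.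

Lemma gl_act_linear f : linear (fun xi => gl_act xi f).
Proof.
have sum_lin (c : 'I_N -> A) (e : 'I_N -> 'I_N * 'I_N) :
    linear (fun xi : 'M[K]_N => \sum_p xi (e p).1 (e p).2 *: c p).
  move=> k x y; rewrite scaler_sumr -big_split; apply: eq_bigr => p _ /=.
  by rewrite !mxE scalerDl scalerA.
apply: linear_add; first exact: sum_lin _ (fun p => (p, f.2)).
exact/linear_opp/(sum_lin _ (fun p => (f.1.2, p))).
Qed.

Lemma gl_act_delta q p a i j : gl_act (delta_mx q p) (a, i, j) =
  ent a i q * (p == j)%:R - (i == q)%:R * ent a p j.
Proof.
rewrite /gl_act /=; congr (_ - _).
  rewrite (bigD1 q) //= big1 => [|r rq].
    by rewrite mxE eqxx addr0 (eq_sym p) /=; case: (j == p); rewrite ?scale1r ?scale0r ?mulr1 ?mulr0.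
  by rewrite mxE (negbTE rq) scale0r.
rewrite (bigD1 p) //= big1 => [|r rq].
  by rewrite mxE eqxx addr0 andbT; case: (i == q); rewrite ?scale1r ?scale0r ?mul1r ?mul0r.
by rewrite mxE (negbTE rq) andbF scale0r.
Qed.

(* The sum of dual bases tr(E'_1 E'_2 E'_3) E_1 (x) E_2 (x) E_3 of gl_N. *)
Definition gl_cubic f g h : A := \sum_p \sum_q \sum_r
  gl_act (delta_mx q p) f * gl_act (delta_mx r q) g * gl_act (delta_mx p r) h.

Lemma sum_delta_r (F : 'I_N -> A) l : \sum_q F q * (q == l)%:R = F l.
Proof.
rewrite (bigD1 l) //= big1 ?addr0 ?eqxx ?mulr1 // => q ql.
by rewrite (negbTE ql) mulr0.
Qed.

Lemma sum_delta_l (F : 'I_N -> A) l : \sum_q (l == q)%:R * F q = F l.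
Proof.
rewrite (bigD1 l) //= big1 ?addr0 ?eqxx ?mul1r // => q ql.
by rewrite eq_sym (negbTE ql) mul0r.
Qed.

(** The sum over one index shared by two matrix units: three of the four products lose it to a
    Kronecker symbol, the fourth becomes an entry of a matrix product. *)
Lemma sum_contract (x z : 'I_N -> A) (u y c d : A) k n :
  \sum_r (x r * u - (k == r)%:R * y) * (c * (r == n)%:R - d * z r) =
  u * c * x n - u * d * (\sum_r x r * z r) - y * c * (k == n)%:R + y * d * z k.
Proof.
pose F r := u * c * x r; pose G r := y * d * z r.
rewrite -[u * c * x n]/(F n) -(sum_delta_r F) -[y * d * z k]/(G k) -(sum_delta_l G).
rewrite -(sum_delta_r (fun r => y * c * (k == r)%:R)).
rewrite mulr_sumr -!sumrB -big_split; apply: eq_bigr => r _ /=.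
by rewrite /F /G; ring.
Qed.

(** The eight terms are, one by one, the entries at [k n i l m j] of the eight monomials of the
    quasi-Poisson Fox property for [c], [b], [a]. *)
Lemma gl_cubicE a b c i j k l m n :
  gl_cubic (a, i, j) (b, k, l) (c, m, n) =
    ent c m j * ent a i l * ent b k n
    - ent c m j * (k == n)%:R * ent (a * b) i l
    - (m == j)%:R * ent (b * c) k n * ent a i l
    + (m == j)%:R * ent c k n * ent (a * b) i l
    - ent (c * a) m j * ent b k n * (i == l)%:R
    + ent (c * a) m j * (k == n)%:R * ent b i l
    + ent a m j * ent (b * c) k n * (i == l)%:R
    - ent a m j * ent c k n * ent b i l.
Proof.
rewrite /gl_cubic !entryM.
transitivity (\sum_p \sum_q
    (ent a i q * (p == j)%:R - (i == q)%:R * ent a p j) *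
    ((ent c m p * ent b k n - (m == p)%:R * (\sum_r ent b k r * ent c r n)) *
       (q == l)%:R -
     (ent c m p * (k == n)%:R - (m == p)%:R * ent c k n) * ent b q l)).
  apply: eq_bigr => p _; apply: eq_bigr => q _.
  under eq_bigr => r _ do rewrite !gl_act_delta -mulrA.
  by rewrite -mulr_sumr sum_contract; ring.
under eq_bigr => p _ do rewrite sum_contract.
set AB := \sum_r ent a i r * ent b r l; set BC := \sum_r ent b k r * ent c r n.
transitivity (\sum_p
  ((ent c m p * ent b k n * ent a i l - ent c m p * (k == n)%:R * AB
    - (m == p)%:R * BC * ent a i l + (m == p)%:R * ent c k n * AB) * (p == j)%:R
   - (ent c m p * ent a p j * (ent b k n * (i == l)%:R - (k == n)%:R * ent b i l))
   + (m == p)%:R * (ent a p j * BC * (i == l)%:R - ent a p j * ent c k n * ent b i l))).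
  by apply: eq_bigr => p _; ring.
rewrite big_split sumrB /= sum_delta_r sum_delta_l -mulr_suml; ring.
Qed.

Lemma gl_jacobiator_quasi f g h : quasi_poisson_fox Delta S rho ->
  gl_jacobiator f g h = 4^-1 *: (gl_cubic f g h - gl_cubic f h g).
Proof.
move=> quasi; case: f => [[a i] j]; case: g => [[b k] l]; case: h => [[c m] n].
rewrite gl_jacobiator_tritensor !quasi !(linear_propZ (tentry3_linear _ _ _ _ _ _)).
rewrite -scalerBr; congr (_ *: _).
have lin3 := tentry3_linear.
rewrite !(linear_propD (lin3 _ _ _ _ _ _)) !(linear_propN (lin3 _ _ _ _ _ _)).
by rewrite !tentry3E !entry1 !gl_cubicE; ring.
Qed.

(** * Projection of gl_N onto the Lie algebra of isometries *)

(* xi |-> - xi^tau; its fixed points are the Lie algebra of isometries. *)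
Definition lie_invol (xi : 'M[K]_N) : 'M[K]_N :=
  \matrix_(p, q) - (sgn p * sgn q * xi (tau q) (tau p)).

Lemma lie_invol_linear : linear lie_invol.
Proof. by move=> k x y; apply/matrixP=> i j; rewrite !mxE; ring. Qed.

Lemma lie_involK : involutive lie_invol.
Proof.
move=> x; apply/matrixP=> i j; rewrite !mxE !tauK sgn_tau2 mulrN opprK mulrA.
by rewrite (mulrC (sgn j)) mulrACA !sgnK !mul1r.
Qed.

Lemma gl_act_flip xi f : gl_act xi (flip f) = gl_act (lie_invol xi) f.
Proof.
case: f => [[a i] j]; rewrite /gl_act /flip /=.
rewrite addrC -sumrN (reindex_inj (inv_inj tauK)) -[in RHS]sumrN.
congr (_ + _).
  apply: eq_bigr => p _; rewrite (linear_propZ (entl _ _)) entryS !tauK !mxE.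
  rewrite scaleNr !scalerA sgn_tau2; congr (- (_ *: _)).
  by rewrite -[RHS]mul1r -(sgnK i); ring.
rewrite (reindex_inj (inv_inj tauK)); apply: eq_bigr => p _ /=.
rewrite (linear_propZ (entl _ _)) entryS !tauK !mxE scaleNr opprK !scalerA sgn_tau2.
by congr (_ *: _); rewrite -[RHS]mul1r -(sgnK j); ring.
Qed.

Lemma mem_lieP xi : reflect (lie_invol xi = xi) (xi \in isometry_lie J).
Proof.
have [_ _ _ JE] := J_twist.
have entry i j : (xi^T *m J + J *m xi) i j =
    xi (tau j) i * sgn (tau j) + sgn i * xi (tau i) j.
  rewrite !mxE; congr (_ + _).
    rewrite (bigD1 (tau j)) //= big1 ?addr0 => [|r rj]; rewrite JE !mxE.
      by rewrite tauK eqxx mulr1n.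
    case: eqP => [jr|_]; last by rewrite mulr0n mulr0.
    by rewrite jr tauK eqxx in rj.
  rewrite (bigD1 (tau i)) //= big1 ?addr0 => [|r ri]; rewrite JE !mxE.
    by rewrite eqxx mulr1n.
  by rewrite (negbTE ri) mulr0n mul0r.
rewrite mem_isometry_lie; apply: (iffP eqP) => [h|h]; apply/matrixP => i j.
  have := entry (tau i) j; rewrite h !mxE tauK => /esym/eqP.
  rewrite addr_eq0 => /eqP e.
  transitivity (sgn (tau i) * (sgn (tau i) * xi i j)); last first.
    by rewrite mulrA sgnK mul1r.
  by rewrite -[sgn (tau i) * xi i j]opprK -e -sgn_tau2; ring.
rewrite entry !mxE -{2}h mxE tauK.
transitivity (xi (tau j) i * (sgn (tau j) - sgn i * sgn (tau i) * sgn j)).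
  by ring.
suff -> : sgn i * sgn (tau i) * sgn j = sgn (tau j) by rewrite subrr mulr0.
by rewrite mulrAC -sgn_tau2 mulrAC sgnK mul1r.
Qed.

Definition lie_proj (xi : 'M[K]_N) := 2^-1 *: (xi + lie_invol xi).

Lemma lie_proj_mem xi : lie_proj xi \in isometry_lie J.
Proof.
apply/mem_lieP; rewrite /lie_proj (linear_propZ lie_invol_linear).
by rewrite (linear_propD lie_invol_linear) lie_involK addrC.
Qed.

(** Self-adjointness makes [lie_proj] the orthogonal projection for the trace form, so pairing a
    projected matrix unit with an isometry just reads off an entry. *)
Lemma trace_lie_invol x y : \tr (lie_invol x *m y) = \tr (x *m lie_invol y).
Proof.
rewrite [RHS]mxtrace_mulC /mxtrace (reindex_inj (inv_inj tauK)) /=.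
apply: eq_bigr => i _; rewrite !mxE (reindex_inj (inv_inj tauK)) /=.
by apply: eq_bigr => j _; rewrite !mxE !tauK sgn_tau2; ring.
Qed.

Lemma trace_lie_proj x y : y \in isometry_lie J -> \tr (lie_proj x *m y) = \tr (x *m y).
Proof.
move=> /mem_lieP yl; rewrite /lie_proj -scalemxAl mxtraceZ mulmxDl mxtraceD.
by rewrite trace_lie_invol yl -mulr2n -(mulr_natl (\tr _)) mulrA mulVf ?mul1r.
Qed.

Lemma trace_delta_mul q p (y : 'M[K]_N) : \tr (delta_mx q p *m y) = y p q.
Proof.
rewrite /mxtrace (bigD1 q) //= big1 ?addr0 => [|i iq].
  rewrite mxE (bigD1 p) //= big1 ?addr0 => [|j jp]; rewrite mxE ?eqxx ?mul1r //.
  by rewrite (negbTE jp) andbF mul0r.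
by rewrite mxE big1 // => j _; rewrite mxE (negbTE iq) mul0r.
Qed.

(** * Dual bases and the Cartan triderivation *)

Local Notation d := (\dim (isometry_lie J)).

Lemma dual_expansion (F F' : d.-tuple 'M[K]_N) v : dual_bases F F' ->
  v \in isometry_lie J -> v = \sum_a \tr (v *m tnth F' a) *: tnth F a.
Proof.
case=> FB _ dual vL; rewrite {1}(coord_basis FB vL).
apply: eq_bigr => a _; rewrite -tnth_nth; congr (_ *: _).
rewrite {2}(coord_basis FB vL) mulmx_suml raddf_sum (bigD1 a) //= big1 ?addr0.
  by rewrite -tnth_nth -scalemxAl mxtraceZ dual eqxx mulr1.
move=> b ba; rewrite -tnth_nth -scalemxAl mxtraceZ dual (negbTE ba) mulr0.
by [].
Qed.

Lemma inf_act_gen xi f : xi \in isometry_lie J ->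
  inf_act xi (pgen (twrep_rel S sgn tau) f) = gl_act xi f.
Proof.
case: f => [[a i] j] xiL.
have [_ _ /(_ a) /matrixP/(_ i j)] := inf_act_well_defined S J_twist xiL.
rewrite !mxE => ->; rewrite /gl_act; congr (_ - _); apply: eq_bigr => p _.
  by rewrite !mxE mulrC.
by rewrite !mxE.
Qed.

Lemma inf_act_derivation xi : xi \in isometry_lie J ->
  derivation (@inf_act K H S N sgn tau xi).
Proof. by move=> xiL; have [? ? _] := inf_act_well_defined S J_twist xiL. Qed.

Definition lie_cubic f g h : A := \sum_p \sum_q \sum_r
  gl_act (lie_proj (delta_mx q p)) f * gl_act (lie_proj (delta_mx r q)) g *
  gl_act (lie_proj (delta_mx p r)) h.

Lemma gl_act_proj xi f :
  gl_act (lie_proj xi) f = 2^-1 *: (gl_act xi f + gl_act xi (flip f)).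
Proof.
rewrite gl_act_flip /lie_proj (linear_propZ (gl_act_linear f)).
by rewrite (linear_propD (gl_act_linear f)).
Qed.

Lemma lie_cubicE f g h : lie_cubic f g h = 8^-1 *:
  (gl_cubic f g h + gl_cubic (flip f) g h + gl_cubic f (flip g) h +
   gl_cubic (flip f) (flip g) h + gl_cubic f g (flip h) +
   gl_cubic (flip f) g (flip h) + gl_cubic f (flip g) (flip h) +
   gl_cubic (flip f) (flip g) (flip h)).
Proof.
rewrite /lie_cubic /gl_cubic -!big_split scaler_sumr; apply: eq_bigr => p _ /=.
rewrite -!big_split scaler_sumr; apply: eq_bigr => q _ /=.
rewrite -!big_split scaler_sumr; apply: eq_bigr => r _ /=.
rewrite !gl_act_proj !(pres_mulZr, =^~ pres_scalerAl) !scalerA -!invfM -!natrM.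
by congr (_ *: _); ring.
Qed.

Lemma tw_jacobiator_quasi f g h : quasi_poisson_fox Delta S rho ->
  jacobiator tw_bider (pgen _ f) (pgen _ g) (pgen _ h) =
  4^-1 *: (lie_cubic f g h - lie_cubic f h g).
Proof.
move=> quasi; rewrite tw_jacobiator_gen; congr (_ *: _).
(* Twisting all three arguments doubles the four terms to the eight that [lie_cubicE] sums over. *)
set x := _ + _; have -> : x = 2^-1 *: (x + x).
  by rewrite -mulr2n -scaler_nat scalerA mulVf ?scale1r.
rewrite {2}/x -(gl_jacobiator_flip f g h) -(gl_jacobiator_flip (flip f) g h).
rewrite -(gl_jacobiator_flip f (flip g) h) -(gl_jacobiator_flip (flip f) (flip g) h).
rewrite !flipK /x !gl_jacobiator_quasi // -!scalerDr scalerA -invfM -natrM.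
by rewrite !lie_cubicE -scalerBr; congr (_ *: _); ring.
Qed.

Definition cubic_coef (F' : d.-tuple 'M[K]_N) (a b c : 'I_d) : K :=
  \tr (tnth F' a *m tnth F' b *m tnth F' c).

(** The coefficients of a projected matrix unit in the basis [F] are entries of the dual basis; the
    sum over [p], [q], [r] closes them up to a trace. *)
Lemma lie_cubic_dual (F F' : d.-tuple 'M[K]_N) f g h : dual_bases F F' ->
  lie_cubic f g h = \sum_a \sum_b \sum_c cubic_coef F' a b c *:
    (gl_act (tnth F a) f * gl_act (tnth F b) g * gl_act (tnth F c) h).
Proof.
move=> dual; have [_ FB' _] := dual.
have F'L (u : 'I_d) : tnth F' u \in isometry_lie J by apply: basis_mem FB' _; apply: mem_tnth.
have act_dual q p e : gl_act (lie_proj (delta_mx q p)) e =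
    \sum_a tnth F' a p q *: gl_act (tnth F a) e.
  rewrite {1}(dual_expansion dual (lie_proj_mem _)).
  rewrite (linear_prop_sum (gl_act_linear e)); apply: eq_bigr => a _.
  by rewrite (linear_propZ (gl_act_linear e)) trace_lie_proj // trace_delta_mul.
transitivity (\sum_p \sum_q \sum_r \sum_a \sum_b \sum_c
    (tnth F' a p q * tnth F' b q r * tnth F' c r p) *:
    (gl_act (tnth F a) f * gl_act (tnth F b) g * gl_act (tnth F c) h)).
  apply: eq_bigr => p _; apply: eq_bigr => q _; apply: eq_bigr => r _.
  rewrite !act_dual big_distrlr big_distrl; apply: eq_bigr => a _ /=.
  rewrite big_distrlr; apply: eq_bigr => b _; apply: eq_bigr => c _ /=.
  by rewrite !(pres_mulZr, =^~ pres_scalerAl) !scalerA; congr (_ *: _); ring.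
under eq_bigr => p _ do under eq_bigr => q _ do rewrite exchange_big.
under eq_bigr => p _ do rewrite exchange_big.
rewrite exchange_big; apply: eq_bigr => a _ /=.
under eq_bigr => p _ do under eq_bigr => q _ do rewrite exchange_big.
under eq_bigr => p _ do rewrite exchange_big.
rewrite exchange_big; apply: eq_bigr => b _ /=.
under eq_bigr => p _ do under eq_bigr => q _ do rewrite exchange_big.
under eq_bigr => p _ do rewrite exchange_big.
rewrite exchange_big; apply: eq_bigr => c _ /=.
rewrite /cubic_coef /mxtrace scaler_suml; apply: eq_bigr => p _.
rewrite mxE scaler_suml exchange_big; apply: eq_bigr => r _.
by rewrite mxE -scaler_suml mulr_suml.
Qed.

(** Reading the signed sum over ['S_3] as a determinant lets [det_mx3] list its six terms. *)
Lemma tri_wedge_det (xi : 'I_3 -> 'M[K]_N) (x y z : A) :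
  tri_wedge xi x y z =
  \det (\matrix_(i, j) inf_act (xi j) (tnth [tuple x; y; z] i)).
Proof.
rewrite /tri_wedge /determinant; apply: eq_bigr => s _.
rewrite !big_ord_recl big_ord0 !mxE mulr1 /=.
have -> : lift ord0 (lift ord0 ord0) = 2 :> 'I_3 by apply/val_inj.
have -> : lift ord0 ord0 = 1 :> 'I_3 by apply/val_inj.
rewrite !(tnth_nth 0) /= [in RHS]mulrA [in RHS]mulrA -[in RHS]mulrA -[in RHS]mulrA.
case: (perm.odd_perm s).
  by rewrite !expr1 scaleN1r mulN1r mulrA.
by rewrite !expr0 scale1r mul1r mulrA.
Qed.

Lemma tri_wedgeE (xi1 xi2 xi3 : 'M[K]_N) (x y z : A)
    (D := @inf_act K H S N sgn tau) :
  tri_wedge (tnth [tuple xi1; xi2; xi3]) x y z =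
  D xi1 x * D xi2 y * D xi3 z - D xi1 x * D xi3 y * D xi2 z
  - D xi2 x * D xi1 y * D xi3 z + D xi2 x * D xi3 y * D xi1 z
  + D xi3 x * D xi1 y * D xi2 z - D xi3 x * D xi2 y * D xi1 z.
Proof. by rewrite tri_wedge_det det_mx3 !mxE !(tnth_nth 0). Qed.

Lemma cubic_coef_cycle (F' : d.-tuple 'M[K]_N) (u v w : 'I_d) :
  cubic_coef F' u v w = cubic_coef F' v w u.
Proof. by rewrite /cubic_coef -mulmxA mxtrace_mulC. Qed.

(** The coefficient [k u v w] is the trace of a basis element against a commutator, hence
    alternating by cyclicity of the trace. The six terms of the wedge therefore contribute equally,
    and 6/12 leaves the factor 1/2. *)
Lemma cartan_gen (F F' : d.-tuple 'M[K]_N) f g h : dual_bases F F' ->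
  (6 : K) != 0 ->
  cartan_triderivation F F' (pgen _ f) (pgen _ g) (pgen _ h) =
  2^-1 *: (lie_cubic f g h - lie_cubic f h g).
Proof.
move=> dual six_neq0; have [FB _ _] := dual.
have FL (u : 'I_d) : tnth F u \in isometry_lie J by apply: basis_mem FB _; apply: mem_tnth.
pose k u v w := cubic_coef F' u v w - cubic_coef F' u w v.
pose P u v w := gl_act (tnth F u) f * gl_act (tnth F v) g * gl_act (tnth F w) h.
pose T := \sum_u \sum_v \sum_w k u v w *: P u v w.
have kC1 u v w : k u v w = k v w u.
  rewrite /k (cubic_coef_cycle _ u v) (cubic_coef_cycle _ u w) .
  by rewrite (cubic_coef_cycle _ w v).
have kN u v w : k u v w = - k u w v by rewrite /k opprB.
have ET : lie_cubic f g h - lie_cubic f h g = T.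
  rewrite !(lie_cubic_dual _ _ _ dual) -sumrB; apply: eq_bigr => u _.
  rewrite [X in _ - X]exchange_big -sumrB; apply: eq_bigr => v _ /=.
  rewrite -sumrB; apply: eq_bigr => w _; rewrite scalerBl; congr (_ - _ *: _).
  by rewrite mulrAC.
have T6 : \sum_u \sum_v \sum_w k u v w *:
   (P u v w - P u w v - P v u w + P v w u + P w u v - P w v u) = 6 *: T.
  pose Sm (G : 'I_d -> 'I_d -> 'I_d -> A) := \sum_u \sum_v \sum_w G u v w.
  have SmD G G' : Sm (fun u v w => G u v w + G' u v w) = Sm G + Sm G'.
    rewrite -big_split; apply: eq_bigr => u _; rewrite -big_split.
    by apply: eq_bigr => v _; rewrite -big_split.
  have sw12 G : Sm (fun u v w => G v u w) = Sm G by rewrite /Sm exchange_big.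
  have sw23 G : Sm (fun u v w => G u w v) = Sm G.
    by apply: eq_bigr => u _; rewrite exchange_big.
  pose G u v w := k u v w *: P u v w.
  transitivity (Sm (fun u v w =>
      G u v w + G u w v + G v u w + G v w u + G w u v + G w v u)).
    apply: eq_bigr => u _; apply: eq_bigr => v _; apply: eq_bigr => w _.
    rewrite /G (kC1 w u v) (kC1 w v u) (kC1 v u w) -(kC1 u v w) (kN u w v).
    by rewrite !scaleNr !scalerDr !scalerN.
  have e3 : Sm (fun u v w => G v w u) = T.
    exact: etrans (sw12 (fun u v w => G u w v)) (sw23 G).
  have e4 : Sm (fun u v w => G w u v) = T.
    exact: etrans (sw23 (fun u v w => G v u w)) (sw12 G).
  have e5 : Sm (fun u v w => G w v u) = T.
    exact: etrans (sw12 (fun u v w => G w u v)) e4.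
  rewrite !SmD e3 e4 e5 (sw12 G) (sw23 G) -[Sm G]/T scaler_nat; ring.
rewrite /cartan_triderivation ET.
transitivity (12^-1 *: (6 *: T)).
  congr (_ *: _); rewrite -T6.
  apply: eq_bigr => u _; apply: eq_bigr => v _; apply: eq_bigr => w _.
  rewrite tri_wedgeE !inf_act_gen // mulmxBr !mulmxA; congr (_ *: _).
  by rewrite [LHS]raddfB.
have -> : (12 : K) = 6 * 2 by rewrite -natrM.
by rewrite scalerA invfM mulrAC mulVf // mul1r.
Qed.

Lemma tri_wedge_derivation (xi1 xi2 xi3 : 'M[K]_N)
    (D := tri_wedge (S := S) (sgn := sgn) (tau := tau) (tnth [tuple xi1; xi2; xi3])) :
  xi1 \in isometry_lie J -> xi2 \in isometry_lie J -> xi3 \in isometry_lie J ->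
  [/\ forall y z, derivation (fun x => D x y z),
     forall x z, derivation (fun y => D x y z)
   & forall x y, derivation (fun z => D x y z)].
Proof.
move=> L1 L2 L3.
have dd (t : 'I_3) : derivation
    (@inf_act K H S N sgn tau (tnth [tuple xi1; xi2; xi3] t)).
  apply: inf_act_derivation; case: t => -[|[|[|//]]] lt3; rewrite (tnth_nth 0) //.
split=> [y z|x z|x y]; apply: derivation_sum => s; apply: derivation_scale.
- by do 2!apply: derivation_mulr.
- by apply: derivation_mulr; apply: derivation_mull.
- by apply: derivation_mull.
Qed.

Lemma cartan_derivation (F F' : d.-tuple 'M[K]_N)
    (D := cartan_triderivation (S := S) (sgn := sgn) (tau := tau) F F') :
  basis_of (isometry_lie J) F ->
  [/\ forall y z, derivation (fun x => D x y z),
     forall x z, derivation (fun y => D x y z)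
   & forall x y, derivation (fun z => D x y z)].
Proof.
move=> FB.
have FL (u : 'I_d) : tnth F u \in isometry_lie J by apply: basis_mem FB _; apply: mem_tnth.
split=> [y z|x z|x y]; apply: derivation_scale; apply: derivation_sum => u;
  apply: derivation_sum => v; apply: derivation_sum => w; apply: derivation_scale;
  by have [h1 h2 h3] := tri_wedge_derivation (FL u) (FL v) (FL w).
Qed.

(** The factor 1/2 of the quasi-Jacobi identity times the 1/2 of [cartan_gen] is the 1/4 of
    [tw_jacobiator_quasi]. Any pair of dual bases will do, since [lie_cubic] is defined without
    them. *)
Lemma tw_quasi_poisson : (6 : K) != 0 -> quasi_poisson_fox Delta S rho ->
  quasi_poisson_bracket J tw_bider.
Proof.
move=> six_neq0 quasi; split.
- exact: tw_bider_biderivation.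
- exact: tw_bider_anti.
- by move=> g g_iso x y; apply: tw_bider_act.
move=> F F' dual; have [FB _ _] := dual.
have [c1 c2 c3] := cartan_derivation F' FB.
apply: tw_jacobiator_eq => [y z|x z|x y|f g h].
- exact/derivation_scale/c1.
- exact/derivation_scale/c2.
- exact/derivation_scale/c3.
rewrite (tw_jacobiator_quasi _ _ _ quasi) cartan_gen // scalerA -invfM -natrM.
by [].
Qed.

Lemma tw_bider_entry a b i j k l : tw_bider (ent a i j) (ent b k l) =
  2^-1 *: tent (db a b) k j i l +
  (2^-1 * sgn i * sgn j) *: tent (db (S a) b) k (tau i) (tau j) l.
Proof.
rewrite [LHS]tw_bider_gen scalerDr; congr (_ + _).
rewrite /flip (linear_propZ (gl_bracket_linearl _ _ _)) scalerA mulrA.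
by [].
Qed.

End TwistedBracket.

(** * Uniqueness of the bracket *)

Section UniqueBracket.
Variables (K : fieldType) (H : algType K) (S : H -> H).
Variables (N : nat) (sgn : 'I_N -> K) (tau : 'I_N -> 'I_N).
Local Notation A := (twrep S sgn tau).

Lemma biderivation_derivations (br : A -> A -> A) : biderivation br ->
  (forall y, derivation (br^~ y)) /\ (forall x, derivation (br x)).
Proof.
case=> ll lr Ml Mr; split=> [y|x]; split=> // x' y'.
by rewrite Ml addrC.
Qed.

(** The entries generate the algebra, so a biderivation is determined by its values on them. [P]
    stands for the kind of bracket and [Q] for the formula, which covers all four cases of the
    theorem. *)
Lemma unique_bracket (P Q : (A -> A -> A) -> Prop) br :
  (forall br, P br -> biderivation br) ->
  (forall br br', Q br -> Q br' -> forall a b i j k l,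
     br (entry a i j) (entry b k l) = br' (entry a i j) (entry b k l)) ->
  P br -> Q br -> exists! br, P br /\ Q br.
Proof.
move=> Pbi Qeq Pbr Qbr; exists br; split=> // br' [Pbr' Qbr'].
have [l r] := biderivation_derivations (Pbi _ Pbr).
have [l' r'] := biderivation_derivations (Pbi _ Pbr').
by apply: biderivation_ext => // -[[a i] j] [[b k] m]; apply: Qeq.
Qed.

End UniqueBracket.

Theorem corollary6p4 (R : realType) (H : algType R[i])
    (Delta : {linear H -> tensor H H}) (eps : {scalar H}) (S : {linear H -> H})
    (rho : H -> H -> H) :
  finitely_generated_alg H ->
  cocommutative_hopf Delta eps S ->
  fox_pairing eps rho ->
  fox_antisymmetric S rho ->
  let db := dbracket Delta S rho in
  let orth_formula (N : nat) (br : orth_rep S N -> orth_rep S N -> orth_rep S N) :=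
    forall (a b : H) (i j k l : 'I_N),
      br (entry a i j) (entry b k l) =
        2%:R^-1 *: tentry (db a b) k j i l
        + 2%:R^-1 *: tentry (db (S a) b) k i j l in
  let symp_formula (n : nat) (br : symp_rep S n -> symp_rep S n -> symp_rep S n) :=
    forall (a b : H) (i j k l : 'I_(n + n)),
      br (entry a i j) (entry b k l) =
        2%:R^-1 *: tentry (db a b) k j i l
        + (2%:R^-1 * symp_sgn _ i * symp_sgn _ j) *:
            tentry (db (S a) b) k (symp_tau i) (symp_tau j) l in
  ((forall x y z : H, tritensor Delta S rho x y z = 0) ->
     (forall N : nat, (0 < N)%N ->
        exists! br, poisson_bracket br /\ orth_formula N br) /\
     (forall n : nat, (0 < n)%N ->
        exists! br, poisson_bracket br /\ symp_formula n br))
  /\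
  (quasi_poisson_fox Delta S rho ->
     (forall N : nat, (0 < N)%N ->
        exists! br, quasi_poisson_bracket (orth_form _ N) br
                    /\ orth_formula N br) /\
     (forall n : nat, (0 < n)%N ->
        exists! br, quasi_poisson_bracket (symp_form _ n) br
                    /\ symp_formula n br)).
Proof.
move=> _ hopf fox anti db orth_formula symp_formula.
have two_neq0 : (2 : R[i]) != 0 by rewrite Num.Theory.pnatr_eq0.
have six_neq0 : (6 : R[i]) != 0 by rewrite Num.Theory.pnatr_eq0.
have orth_uniq N br br' : orth_formula N br -> orth_formula N br' ->
    forall a b i j k l,
      br (entry a i j) (entry b k l) = br' (entry a i j) (entry b k l).
  by move=> h h' a b i j k l; rewrite h h'.
have symp_uniq n br br' : symp_formula n br -> symp_formula n br' ->
    forall a b i j k l,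
      br (entry a i j) (entry b k l) = br' (entry a i j) (entry b k l).
  by move=> h h' a b i j k l; rewrite h h'.
have orth_tw N : orth_formula N (@tw_bider _ _ Delta S rho N (@orth_sgn _ N) (@orth_tau N)).
  move=> a b i j k l.
  by rewrite (tw_bider_entry hopf fox anti (orth_twist_form _ N)) /orth_sgn !mulr1.
have symp_tw n := tw_bider_entry hopf fox anti (symp_twist_form R[i] n).
split=> [tri0|quasi]; split=> [N _|n _].
- apply: unique_bracket (@orth_uniq N) _ (orth_tw N); first by move=> br [].
  exact: (tw_poisson hopf fox anti (orth_twist_form _ N) tri0).
- apply: unique_bracket (@symp_uniq n) _ (symp_tw n); first by move=> br [].
  exact: (tw_poisson hopf fox anti (symp_twist_form _ n) tri0).
- apply: unique_bracket (@orth_uniq N) _ (orth_tw N); first by move=> br [].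
  exact: (tw_quasi_poisson hopf fox anti (orth_twist_form _ N) two_neq0 six_neq0 quasi).
- apply: unique_bracket (@symp_uniq n) _ (symp_tw n); first by move=> br [].
  exact: (tw_quasi_poisson hopf fox anti (symp_twist_form _ n) two_neq0 six_neq0 quasi).
Qed.
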